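(* Let $A,B\in\mathcal{CR}$ and let $\mathcal{J}$ be a proper operator ideal. Assume that $|A|$ is a diagonalizable operator and let $\{V_\lambda\}_{\lambda\in\sigma_p(|A|)\setminus\{0\}}$ denote the partial isometries of the block singular value decomposition of $A$. Then the following are equivalent: (i) there exists $U\in\mathcal{U}_{\mathcal J}$ such that $UA=B$; (ii) $|B|$ is diagonalizable, $\sigma_p(|B|)=\sigma_p(|A|)$, and, if $\{W_\lambda\}_{\lambda\in\sigma_p(|A|)\setminus\{0\}}$ denotes the partial isometries of the block singular value decomposition of $B$, then $V_\lambda^*V_\lambda=W_\lambda^*W_\lambda$ for all $\lambda\in\sigma_p(|A|)\setminus\{0\}$, and $$\sum_{\lambda\in\sigma_p(|A|)\setminus\{0\}}(W_\lambda-V_\lambda)V_\lambda^*\in\mathcal{J}\quad\text{and}\quad\sum_{\lambda\in\sigma_p(|A|)\setminus\{0\}}(V_\lambda-W_\lambda)W_\lambda^*\in\mathcal{J},$$ where the series converge in the operator norm.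
   Context: $\mathcal{H}$ is a separable infinite-dimensional complex Hilbert space, $\mathcal{B}(\mathcal{H})$ the algebra of bounded operators on it. $\mathcal{CR}=\{A\in\mathcal{B}(\mathcal{H}): \text{the range of }A\text{ is closed}\}$. An operator ideal is a two-sided ideal $\mathcal{J}$ of $\mathcal{B}(\mathcal{H})$; it is proper if $\{0\}\ne\mathcal{J}\neq\mathcal{B}(\mathcal{H})$. $\mathcal{U}_{\mathcal J}=\{U \text{ unitary on }\mathcal{H}: U-I\in\mathcal{J}\}$. $|A|=(A^*A)^{1/2}$, and $A=V_A|A|$ is the polar decomposition, with $V_A$ the partial isometry satisfying $N(V_A)=N(A)$ ($N$ = nullspace). An operator is diagonalizable if there is an orthonormal basis of $\mathcal{H}$ consisting of eigenvectors of it. $\sigma_p(T)$ denotes the point spectrum (set of eigenvalues). Block singular value decomposition: if $A\in\mathcal{CR}$ and $|A|$ is diagonalizable, let $P_\lambda$ be the spectral projection of $|A|$ associated with $\lambda\in\sigma_p(|A|)$ (orthogonal projection onto the eigenspace) and put $V_\lambda=V_AP_\lambda$ for $\lambda\in\sigma_p(|A|)\setminus\{0\}$. Then the $V_\lambda$ are partial isometries and $A=\sum_{\lambda\in\sigma_p(|A|)\setminus\{0\}}\lambda V_\lambda$ in the strong operator topology; $\{V_\lambda\}$ are the partial isometries of the block singular value decomposition of $A$ (similarly for $B$). *)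

(* Defs.v *)
From HB Require Import structures.
From mathcomp Require Import all_boot all_order all_algebra finmap.
From mathcomp Require Import complex.
From mathcomp Require Import all_classical all_reals all_analysis.
From mathcomp Require Import summability.

Set Implicit Arguments.
Unset Strict Implicit.
Unset Printing Implicit Defensive.

Import Order.TTheory GRing.Theory Num.Theory.
Import numFieldNormedType.Exports.

Local Open Scope complex_scope.
Local Open Scope classical_set_scope.
Local Open Scope ring_scope.

HB.mixin Record NormedModule_isHilbert (R : realType) H
    of NormedModule R[i] H := {
  (* linear in the first argument, conjugate-linear in the second *)
  inner : {dot H for @Num.conj R[i]} ;
  inner_norm : forall x : H, `|x| ^+ 2 = inner x x
}.

#[short(type="hilbertType")]
HB.structure Definition Hilbert (R : realType) :=
  {H of CompleteNormedModule R[i] H & NormedModule_isHilbert R H}.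

Definition separable_space (T : topologicalType) : Prop :=
  exists2 D : set T, countable D & dense D.

Definition infinite_dimensional (K : fieldType) (V : lmodType K) : Prop :=
  ~ exists n (v : 'I_n -> V),
      forall x, exists c : 'I_n -> K, x = \sum_i c i *: v i.

Section BoundedOperators.
Context {R : realType} (H : hilbertType R).

Definition bounded_op : {pred H -> H} :=
  mem [set f : H -> H | linear f /\ continuous f].

(* B(H) *)
Record bop := Bop { bop_fun :> H -> H ; _ : bop_fun \in bounded_op }.

HB.instance Definition _ := [isSub for bop_fun].
HB.instance Definition _ := [Choice of bop by <:].

Lemma bounded_opP (f : H -> H) :
  reflect (linear f /\ continuous f) (f \in bounded_op).
Proof. by apply: (iffP idP) => [/set_mem//|?]; apply/mem_set. Qed.

Lemma bopP (T : bop) : linear T /\ continuous T.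
Proof. exact/bounded_opP/(valP T). Qed.

Lemma bop_ext (S T : bop) : S =1 T -> S = T.
Proof. by move=> ST; apply/val_inj/funext. Qed.

Lemma bounded_op_submod : submod_closed bounded_op.
Proof.
split=> [|a f g /bounded_opP[fl fc] /bounded_opP[gl gc]]; apply/bounded_opP.
  split=> [k x y|x]; first by rewrite /= scaler0 addr0.
  exact: cvg_cst.
split=> [k x y|x].
  rewrite !fctE fl gl !scalerDr !scalerA (mulrC a k).
  by rewrite addrACA.
by apply: continuousD; [apply: continuousZr; exact: fc|exact: gc].
Qed.

HB.instance Definition _ :=
  GRing.isSubmodClosed.Build R[i] (H -> H) bounded_op bounded_op_submod.
HB.instance Definition _ := [SubChoice_isSubLmodule of bop by <:].

Lemma bounded_op_id : idfun \in bounded_op.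
Proof. by apply/bounded_opP; split=> // x; exact: cvg_id. Qed.

Lemma bounded_op_comp (S T : bop) : S \o T \in bounded_op.
Proof.
have [Sl Sc] := bopP S; have [Tl Tc] := bopP T.
apply/bounded_opP; split=> [k x y|x]; first by rewrite /= Tl Sl.
by apply: continuous_comp; [exact: Tc|exact: Sc].
Qed.

Definition bop_one : bop := Bop bounded_op_id.
Definition bop_mul (S T : bop) : bop := Bop (bounded_op_comp S T).

Fact bop_mulA : associative bop_mul. Proof. by move=> *; exact: bop_ext. Qed.
Fact bop_mul1 : left_id bop_one bop_mul. Proof. by move=> *; exact: bop_ext. Qed.
Fact bop_mulr1 : right_id bop_one bop_mul.
Proof. by move=> *; exact: bop_ext. Qed.
Fact bop_mulDl : left_distributive bop_mul +%R.
Proof. by move=> *; exact: bop_ext. Qed.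
Fact bop_mulDr : right_distributive bop_mul +%R.
Proof.
move=> S T1 T2; apply: bop_ext => x /=.
have [Sl _] := bopP S.
by have := Sl 1 (T1 x) (T2 x); rewrite !scale1r.
Qed.

(* The product of B(H) is composition and its unit the identity. *)
HB.instance Definition _ := GRing.Zmodule_isPzRing.Build bop
  bop_mulA bop_mul1 bop_mulr1 bop_mulDl bop_mulDr.

End BoundedOperators.

Notation "''B' ( H )" := (bop H) (at level 8, format "''B' ( H )") : type_scope.

Section OperatorTheory.
Context {R : realType} {H : hilbertType R}.
Implicit Types (A S T U V P : 'B(H)) (J : set 'B(H)) (x y : H) (l : R[i]).

(* The norm of H takes its (real) values in R[i], hence the projection Re. *)
Definition opnorm T : R :=
  sup [set complex.Re `|T x| | x in [set x : H | `|x| <= 1]].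

(* Convergence in operator norm of the net of finite partial sums. *)
Definition norm_series_cvg (I : choiceType) (f : I -> 'B(H)) S : Prop :=
  opnorm (partial_sum f F - S) @[F --> totally] --> (0 : R).

Definition closed_range A : Prop := closed (range A).

(* The objects below defined with [xget 0] exist and are unique by classical
   Hilbert space theory (for [sqrtop S], when S is positive); the default value
   0 is never used. *)

Definition adjoint A : 'B(H) :=
  xget 0 [set T : 'B(H) | forall x y, inner (A x) y = inner x (T y)].

Definition positive_op T : Prop := forall x, 0 <= inner (T x) x.

Definition sqrtop S : 'B(H) := xget 0 [set T : 'B(H) | positive_op T /\ T * T = S].

Definition modulus A : 'B(H) := sqrtop (adjoint A * A).

Definition nullspace T : set H := [set x | T x = 0].

Definition partial_isometry V : Prop :=
  forall x, (forall y, nullspace V y -> inner x y = 0) -> `|V x| = `|x|.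

Definition polar_part A : 'B(H) :=
  xget 0 [set V : 'B(H) | [/\ partial_isometry V, A = V * modulus A &
                      nullspace V = nullspace A]].

Definition unitary U : Prop := adjoint U * U = 1 /\ U * adjoint U = 1.

Definition eigenspace T l : set H := [set x | T x = l *: x].

Definition point_spectrum T : set R[i] :=
  [set l | exists2 x, x != 0 & eigenspace T l x].

Definition orthogonal_projection P : Prop := P * P = P /\ adjoint P = P.

Definition eigenprojection T l : 'B(H) :=
  xget 0 [set P : 'B(H) | orthogonal_projection P /\ range P = eigenspace T l].

(* Orthonormal bases are indexed by nat: they are only used when H is separable
   and infinite-dimensional. *)
Definition orthonormal_basis (e : nat -> H) : Prop :=
  (forall i j, inner (e i) (e j) = (i == j)%:R) /\
  (forall x, (\sum_(0 <= k < n) inner x (e k) *: e k) @[n --> \oo] --> x).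

Definition diagonalizable_op T : Prop :=
  exists2 e, orthonormal_basis e & forall n, exists l, eigenspace T l (e n).

Definition nonzero_point_spectrum T : set R[i] := point_spectrum T `\ 0.

(* The partial isometries V_l of the block singular value decomposition. *)
Definition bsvd_part A l : 'B(H) :=
  polar_part A * eigenprojection (modulus A) l.

Definition operator_ideal J : Prop :=
  [/\ J 0, (forall S T, J S -> J T -> J (S + T)) &
      (forall A T, J T -> J (A * T) /\ J (T * A))].

Definition proper_operator_ideal J : Prop :=
  [/\ operator_ideal J, J <> [set 0] & J <> setT].

(* The group U_J *)
Definition unitary_ideal J : set 'B(H) := [set U | unitary U /\ J (U - 1)].

End OperatorTheory.

(* Main.v *)
Require Import Defs.
From HB Require Import structures.
From mathcomp Require Import all_boot all_order all_algebra finmap.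
From mathcomp Require Import complex.
From mathcomp Require Import all_classical all_reals all_analysis.
From mathcomp Require Import summability ring lra.
Set Implicit Arguments.
Unset Strict Implicit.
Unset Printing Implicit Defensive.
Import Order.TTheory GRing.Theory Num.Theory.
Import numFieldNormedType.Exports.
Local Open Scope complex_scope.
Local Open Scope classical_set_scope.
Local Open Scope ring_scope.

(* (i) => (ii): |B| = |A| and W_l = U V_l, so the first series is K P_l V^* summed
   over l, with K = (U - 1) V in J and P_l the eigenprojections of |A|. It
   converges in norm because K has small tails along any orthonormal basis: an
   operator not tending to 0 on some orthonormal sequence is bounded below on an
   infinite-dimensional subspace, and an ideal containing it contains 1.

   (ii) => (i): |B| = |A|, and for p = V V^*, q = W W^*, Z = W V^* the sum of the
   first series is Z - p. As J is closed under adjoints, q - p is in J and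
   G = Z + (1 - q)(1 - p) is in 1 + J. By the Fredholm alternative, as long as G
   is not invertible both N(G) and N(G^* ) are nonzero, and G can be corrected by a
   rank one partial isometry from N(G) to N(G^* ) while keeping G p = Z and
   q G = Z. This stops, since it removes orthonormal vectors u_k with
   (G - 1) u_k = - u_k. For the invertible G so obtained U = G |G|^-1 is unitary,
   lies in 1 + J, and U p = Z yields U A = B. *)

(** The equation [U * A = B] prescribes [U] only on the range of [A], so (ii) => (i) is an extension
    problem: the null spaces of [p] and [q] have to be matched by a unitary that differs from 1 by a
    member of J. The operator [(1 - q) * (1 - p)] nearly does this, but may fail to be injective or
    onto between them. That both failures have the same size is an index zero statement; the
    Fredholm alternative delivers it one dimension at a time, as a kernel vector paired with a
    cokernel vector, and no index has to be defined. Properness of J enters twice: [J <> setT] gives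
    [~ J 1], whose consequences [ideal_ons] and [ideal_tail] do the work of compactness, and [J <>
    [set 0]] puts the rank one corrections into J. Adjoints, square roots, polar parts and
    eigenprojections are chosen by [xget], so each becomes usable only after an existence proof.
    Douglas factorization serves both the polar decomposition and the closure of J under
    adjoints. *)

(** * Real-valued norm, inner product, Cauchy-Schwarz *)

Section HilbertBasics.
Context {R : realType} {H : hilbertType R}.
Implicit Types (x y z : H) (a b : R[i]).

(** Real-valued so that [lra], [nra], [sup] and [inf] over [R] apply; [nrmE] translates back to
    [R[i]]. *)
Definition nrm x : R := complex.Re `|x|.

Lemma nrmE x : `|x| = (nrm x)%:C.
Proof. by rewrite /nrm RRe_real // normr_real. Qed.

Lemma nrm_ge0 x : 0 <= nrm x.
Proof. by rewrite -lecR -nrmE normr_ge0. Qed.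

Lemma nrm_eq0 x : (nrm x == 0) = (x == 0).
Proof. by rewrite -(normr_eq0 x) nrmE -(inj_eq (@complexI R)). Qed.

Lemma nrm_gt0 x : (0 < nrm x) = (x != 0).
Proof. by rewrite lt_def nrm_eq0 nrm_ge0 andbT. Qed.

Lemma nrm0 : nrm 0 = 0.
Proof. by apply/eqP; rewrite nrm_eq0. Qed.

Lemma nrmN x : nrm (- x) = nrm x.
Proof. by rewrite /nrm normrN. Qed.

Lemma ler_nrmD x y : nrm (x + y) <= nrm x + nrm y.
Proof. by rewrite -lecR rmorphD /= -!nrmE ler_normD. Qed.

Lemma ler_nrmB x y : nrm (x - y) <= nrm x + nrm y.
Proof. by rewrite (le_trans (ler_nrmD _ _))// nrmN. Qed.

Lemma nrmBC x y : nrm (x - y) = nrm (y - x).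
Proof. by rewrite -nrmN opprB. Qed.

Lemma nrmZ a x : nrm (a *: x) = Normc.normc a * nrm x.
Proof. by apply: complexI; rewrite -nrmE normrZ rmorphM/= -nrmE normc_def; case: a. Qed.

Lemma innerDl x y z : inner (x + y) z = inner x z + inner y z.
Proof. exact: linearDl. Qed.
Lemma innerBl x y z : inner (x - y) z = inner x z - inner y z.
Proof. exact: linearBl. Qed.
Lemma innerNl x z : inner (- x) z = - inner x z.
Proof. exact: linearNl. Qed.
Lemma inner0l z : inner 0 z = 0 :> R[i].
Proof. exact: linear0l. Qed.
Lemma innerZl a x z : inner (a *: x) z = a * inner x z.
Proof. exact: linearZl_LR. Qed.
Lemma innerDr x y z : inner z (x + y) = inner z x + inner z y.
Proof. exact: linearDr. Qed.
Lemma innerBr x y z : inner z (x - y) = inner z x - inner z y.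
Proof. exact: linearBr. Qed.
Lemma innerNr x z : inner z (- x) = - inner z x.
Proof. exact: linearNr. Qed.
Lemma inner0r z : inner z 0 = 0 :> R[i].
Proof. exact: linear0r. Qed.
Lemma innerZr a x z : inner z (a *: x) = Num.conj a * inner z x.
Proof. exact: linearZr_LR. Qed.
Lemma innerC x y : inner x y = Num.conj (inner y x) :> R[i].
Proof. by rewrite hermC expr0 mul1r. Qed.

Lemma nrm_inner x : inner x x = (nrm x ^+ 2)%:C.
Proof. by rewrite -inner_norm nrmE -rmorphXn. Qed.

Lemma nrm_sq x : nrm x ^+ 2 = complex.Re (inner x x).
Proof. by rewrite nrm_inner. Qed.

Lemma Re_conj a : complex.Re (Num.conj a) = complex.Re a.
Proof. by case: a. Qed.

Lemma Re_innerC x y : complex.Re (inner x y) = complex.Re (inner y x).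
Proof. by rewrite innerC Re_conj. Qed.

Lemma nrm_sqD x y :
  nrm (x + y) ^+ 2 = nrm x ^+ 2 + nrm y ^+ 2 + 2 * complex.Re (inner x y).
Proof.
rewrite !nrm_sq innerDl !innerDr !raddfD /= (innerC y x) Re_conj.
by rewrite mulr_natl mulr2n; lra.
Qed.

Lemma nrm_sqB x y :
  nrm (x - y) ^+ 2 = nrm x ^+ 2 + nrm y ^+ 2 - 2 * complex.Re (inner x y).
Proof. by rewrite nrm_sqD nrmN innerNr raddfN /= mulrN. Qed.

Lemma normc_sq a : (Normc.normc a ^+ 2)%:C = a * Num.conj a.
Proof. by rewrite -normCK normc_def -rmorphXn; case: a. Qed.

Lemma normc_ge0 a : 0 <= Normc.normc a.
Proof. by case: a => *; exact: sqrtr_ge0. Qed.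

(** The square being expanded is that of |y|^2 x - <x, y> y, the component of [x] orthogonal to [y]
    with its denominator cleared. *)
Lemma cauchy_schwarz x y : Normc.normc (inner x y) <= nrm x * nrm y.
Proof.
have [->|y0] := eqVneq y 0; first by rewrite inner0r Normc.normc0 nrm0 mulr0.
set c := inner x y; have yp : 0 < nrm y by rewrite nrm_gt0.
rewrite -ler_sqr ?nnegrE ?mulr_ge0 ?nrm_ge0 ?normc_ge0//.
have := sqr_ge0 (nrm ((nrm y ^+ 2)%:C *: x - c *: y)).
have hY : Normc.normc (nrm y ^+ 2)%:C = nrm y ^+ 2.
  by rewrite /Normc.normc /= expr0n addr0 sqrtr_sqr ger0_norm ?sqr_ge0.
rewrite nrm_sqB !nrmZ hY innerZl innerZr -/c (mulrC _ c) -normc_sq -rmorphM /=.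
move=> h; rewrite -subr_ge0 -(pmulr_rge0 _ (exprn_gt0 2 yp)).
by move: h; congr (_ <= _); ring.
Qed.

Lemma Re_le_normc a : complex.Re a <= Normc.normc a.
Proof.
have := normc_ge_Re a; rewrite normc_def lecR => /(le_trans (ler_norm _)).
by case: a.
Qed.

Lemma cauchy_schwarz_Re x y : complex.Re (inner x y) <= nrm x * nrm y.
Proof. exact: le_trans (Re_le_normc _) (cauchy_schwarz _ _). Qed.

Lemma cvg_nrmP (T : Type) (F : set_system T) (FF : Filter F) (f : T -> H) x :
  f @ F --> x <-> forall e : R, 0 < e -> \forall t \near F, nrm (f t - x) < e.
Proof.
split=> [/cvgrPdistC_lt fx e e0|fx].
  have e0' : 0 < e%:C by rewrite ltcR.
  by near do rewrite -ltcR -nrmE; apply: fx.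
apply/cvgrPdistC_lt => e e0.
have eE : e = (complex.Re e)%:C by rewrite RRe_real// gtr0_real.
rewrite eE ltcR in e0 *.
by near do rewrite nrmE ltcR; apply: fx.
Unshelve. all: by end_near. Qed.

Lemma cvgn_nrmP (u : nat -> H) x : u @ \oo --> x <->
  forall e : R, 0 < e -> exists N, forall n, (N <= n)%N -> nrm (u n - x) < e.
Proof.
rewrite cvg_nrmP; split=> h e /h; last by case=> N hN; exists N.
by case=> N _ hN; exists N => n; apply: hN.
Qed.

Lemma cauchy_nrm (u : nat -> H) :
  (forall e : R, 0 < e ->
    exists N, forall n, (N <= n)%N -> nrm (u n - u N) < e) ->
  exists x, u @ \oo --> x.
Proof.
move=> uC; suff : cvg (u @ \oo) by move=> ?; exists (lim (u @ \oo)).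
apply: cauchy_cvg; apply: cauchy_exP => e e0.
have eE : e = (complex.Re e)%:C by rewrite RRe_real// gtr0_real.
rewrite eE ltcR in e0 *; have [N hN] := uC _ e0.
exists (u N); exists N => // n /= Nn.
by rewrite -ball_normE /ball_ /= nrmE ltcR nrmBC hN.
Qed.

End HilbertBasics.

(** * Bounded operators, orthogonal projections, Riesz representation, adjoints *)

Section Operators.
Context {R : realType} {H : hilbertType R}.
Implicit Types (x y z : H) (a b : R[i]) (A S T U : 'B(H)) (M : set H).

Lemma cvgn_nrm (u : nat -> H) x (e : R) : u @ \oo --> x -> 0 < e ->
  exists N, forall n, (N <= n)%N -> nrm (u n - x) < e.
Proof. by rewrite cvgn_nrmP => + e0; apply. Qed.

Lemma ler_eps (r s : R) : (forall e : R, 0 < e -> r <= s + e) -> r <= s.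
Proof. by move=> h; apply/ler_addgt0Pr => e; exact: h. Qed.

Lemma conj_real (r : R) : Num.conj r%:C = r%:C :> R[i].
Proof. exact: conjc_real. Qed.

Lemma conjM a b : Num.conj (a * b) = Num.conj a * Num.conj b.
Proof. exact: rmorphM. Qed.

Lemma bop_linear T a x y : T (a *: x + y) = a *: T x + T y.
Proof. by have [+ _] := bopP T; apply. Qed.
Lemma bopD T x y : T (x + y) = T x + T y.
Proof. by have := bop_linear T 1 x y; rewrite !scale1r. Qed.
Lemma bop0 T : T 0 = 0.
Proof. by apply: (addIr (T 0)); rewrite -bopD !add0r. Qed.
Lemma bopZ T a x : T (a *: x) = a *: T x.
Proof. by have := bop_linear T a x 0; rewrite bop0 !addr0. Qed.
Lemma bopN T x : T (- x) = - T x.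
Proof. by rewrite -scaleN1r bopZ scaleN1r. Qed.
Lemma bopB T x y : T (x - y) = T x - T y.
Proof. by rewrite bopD bopN. Qed.
Lemma bop_sum T (I : Type) (r : seq I) (P : pred I) (F : I -> H) :
  T (\sum_(i <- r | P i) F i) = \sum_(i <- r | P i) T (F i).
Proof. by apply: (big_morph T (bopD T) (bop0 T)). Qed.

Lemma addE S T x : (S + T) x = S x + T x. Proof. by []. Qed.
Lemma oppE S x : (- S) x = - S x. Proof. by []. Qed.
Lemma subE S T x : (S - T) x = S x - T x. Proof. by []. Qed.
Lemma mulE S T x : (S * T) x = S (T x). Proof. by []. Qed.
Lemma oneE x : (1 : 'B(H)) x = x. Proof. by []. Qed.
Lemma zeroE x : (0 : 'B(H)) x = 0. Proof. by []. Qed.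
Lemma scaleE a S x : (a *: S) x = a *: S x. Proof. by []. Qed.
Lemma sumE (I : Type) (r : seq I) (P : pred I) (F : I -> 'B(H)) x :
  (\sum_(i <- r | P i) F i) x = \sum_(i <- r | P i) F i x.
Proof. by apply: (big_morph (fun S : 'B(H) => S x)). Qed.

Definition bopE := (addE, oppE, mulE, oneE, zeroE, scaleE).

Lemma normc_real (r : R) : 0 <= r -> Normc.normc r%:C = r.
Proof. by move=> r0; rewrite /Normc.normc/= expr0n addr0 sqrtr_sqr ger0_norm. Qed.

Lemma nrmZr (r : R) x : 0 <= r -> nrm (r%:C *: x) = r * nrm x.
Proof. by move=> r0; rewrite nrmZ normc_real. Qed.

Lemma bop_bounded T : exists2 C : R, 0 < C & forall x, nrm (T x) <= C * nrm x.
Proof.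
have [_ Tc] := bopP T.
have : T y @[y --> (0 : H)] --> T 0 by exact: Tc.
rewrite cvg_nrmP => /(_ 1 ltr01); rewrite bop0.
move=> /nbhs_ballP[d d0 hd]; have dE : d = (complex.Re d)%:C.
  by rewrite RRe_real// gtr0_real.
rewrite dE /= ltcR in d0 hd; set r := complex.Re d in d0 hd.
exists (2 / r) => [|x]; first by rewrite divr_gt0.
have [->|x0] := eqVneq x 0; first by rewrite bop0 !nrm0 mulr0.
have np : 0 < nrm x by rewrite nrm_gt0.
(* The test vector is [x] rescaled to norm [r / 2], inside the ball of radius [r]. *)
have := hd ((r / 2 / nrm x)%:C *: x).
rewrite -ball_normE /ball_ /= sub0r normrN nrmE ltcR subr0 bopZ.
have cp : 0 < r / 2 / nrm x by rewrite !divr_gt0.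
rewrite !nrmZr ?(ltW cp)// divfK ?gt_eqF//.
move=> /(_ ltac:(by rewrite ltr_pdivrMr// mulr2n mulrDr mulr1 ltrDl)) /ltW.
rewrite -ler_pdivlMl// => /le_trans; apply.
suff -> : (r / 2 / nrm x)^-1 * 1 = 2 / r * nrm x by [].
by field; rewrite !gt_eqF.
Qed.

(** Riesz representatives, pointwise limits, extensions by continuity and inverses are first built
    as plain functions; this turns them into operators. *)
Lemma mkbop (f : H -> H) (C : R) : linear f ->
  (forall x, nrm (f x) <= C * nrm x) -> exists T : 'B(H), T =1 f.
Proof.
move=> fl fC; suff fb : f \in @bounded_op R H by exists (Bop fb).
apply/bounded_opP; split=> // x; apply/cvg_nrmP => e e0.
have fB y z : f y - f z = f (y - z).
  by have := fl 1 (y - z) z; rewrite !scale1r subrK => ->; rewrite addrK.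
have Cp : 0 < `|C| + 1 by rewrite ltr_wpDl.
have d0 : 0 < e / (`|C| + 1) by rewrite divr_gt0.
have : y @[y --> x] --> x by exact: cvg_id.
rewrite cvg_nrmP => /(_ _ d0); apply: filterS => y; rewrite ltr_pdivlMr//.
rewrite fB => /(le_lt_trans _); apply; apply: (le_trans (fC _)).
by rewrite mulrC ler_wpM2l ?nrm_ge0// (le_trans (ler_norm _))// lerDl.
Qed.

Lemma natSinv_lt (e : R) : 0 < e ->
  exists N, forall n, (N <= n)%N -> n.+1%:R^-1 < e.
Proof.
move=> e0; have [N _ hN] := near_infty_natSinv_lt (PosNum e0).
by exists N => n /hN.
Qed.

Definition closed_subspace M := [/\ M 0,
  forall a x y, M x -> M y -> M (a *: x + y) &
  forall x, (forall e : R, 0 < e -> exists2 y, M y & nrm (y - x) < e) -> M x].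

(** A minimizer of the distance to [M]: minimizing sequences are Cauchy by convexity, and varying
    the minimizer in the direction [z] gives orthogonality. *)
Lemma proj_point M x : closed_subspace M ->
  exists2 y, M y & forall z, M z -> inner (x - y) z = 0 :> R[i].
Proof.
move=> [M0 Ml Mc]; pose E := [set nrm (x - y) | y in M]; pose D := inf E.
have Ei : has_inf E.
  split; first by exists (nrm (x - 0)); exists 0.
  by exists 0 => _ [y _ <-]; exact: nrm_ge0.
have DE y : M y -> D <= nrm (x - y) by move=> My; apply: ge_inf; [case: Ei|exists y].
have D0 : 0 <= D by apply: lb_le_inf; [case: Ei|move=> _ [y _ <-]; exact: nrm_ge0].
have ex n : {y | M y /\ nrm (x - y) < D + n.+1%:R^-1}.
  apply: cid; have [|_ [y My <-] hy] := @inf_adherent _ E n.+1%:R^-1 _ Ei.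
    by rewrite invr_gt0.
  by exists y.
pose u n := sval (ex n).
have uM n : M (u n) by rewrite /u; case: (ex n) => /= ? [].
have ud n : nrm (x - u n) < D + n.+1%:R^-1 by rewrite /u; case: (ex n) => /= ? [].
(* Parallelogram law: the midpoint of [u n] and [u m] lies in [M], so the left side is at most 4 (D
   + e)^2 - 4 D^2. *)
have near (n m : nat) (e : R) : 0 < e -> nrm (x - u n) <= D + e ->
    nrm (x - u m) <= D + e -> nrm (u n - u m) ^+ 2 <= 8 * D * e + 4 * e ^+ 2.
  move=> e0 hn hm.
  have h1 := DE ((1 / 2)%:C *: u n + ((1 / 2)%:C *: u m + 0)) 
    (Ml _ _ _ (uM n) (Ml _ _ _ (uM m) M0)).
  have : nrm ((x - u n) + (x - u m)) = 2 * nrm (x - ((1 / 2)%:C *: u n + ((1 / 2)%:C *: u m + 0))).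
    rewrite -nrmZr//; congr nrm.
    rewrite addr0 -scalerDr scalerBr scalerA -rmorphM/= mul1r divff// scale1r.
    by rewrite rmorph_nat scaler_nat mulr2n opprD addrACA.
  have : u n - u m = (x - u m) - (x - u n) by rewrite opprB [RHS]addrC subrKA.
  move=> ->; have := nrm_sqD (x - u n) (x - u m); have := nrm_sqB (x - u m) (x - u n).
  rewrite (Re_innerC (x - u m)) => -> + E2.
  rewrite E2 => E3.
  have n1 := nrm_ge0 (x - u n); have n2 := nrm_ge0 (x - u m).
  by nra.
have [y uy] : exists y, u @ \oo --> y.
  apply: cauchy_nrm => e e0.
  (* For 0 < t < 1, 8 D t + 4 t^2 < (8 D + 5) t, so the second entry of the minimum below brings the
     bound under e^2. *)
  have K0 : 0 < 8 * D + 5 by rewrite ltr_wpDl// mulr_ge0.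
  have d0 : 0 < Num.min 1 (e ^+ 2 / (8 * D + 5)).
    by rewrite lt_min ltr01 divr_gt0 ?exprn_gt0.
  have [N hN] := natSinv_lt d0; exists N => n Nn.
  have iN : n.+1%:R^-1 <= N.+1%:R^-1 :> R by rewrite lef_pV2 ?posrE// ler_nat.
  have r0 : 0 < N.+1%:R^-1 :> R by rewrite invr_gt0.
  have := near n N _ r0 (le_trans (ltW (ud n)) (lerD (lexx _) iN)) (ltW (ud N)).
  have := hN N (leqnn _); rewrite lt_min ltr_pdivlMr// => /andP[r1 r2] h.
  rewrite -ltr_sqr ?nnegrE ?nrm_ge0 ?(ltW e0)// (le_lt_trans h)//.
  by apply: lt_trans r2; move: r0 r1; set t := _^-1; nra.
have yM : M y.
  by apply: Mc => e /(cvgn_nrm uy)[N hN]; exists (u N); rewrite ?hN.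
have yD : nrm (x - y) <= D.
  apply: ler_eps => e e0; have e2 : 0 < e / 2 by rewrite divr_gt0.
  have [N1 h1] := cvgn_nrm uy e2; have [N2 h2] := natSinv_lt e2.
  have := h1 _ (leq_maxl N1 N2); have := h2 _ (leq_maxr N1 N2).
  have := ud (maxn N1 N2); set n := maxn _ _.
  have := ler_nrmD (x - u n) (u n - y); rewrite addrA subrK.
  by move: (n.+1%:R^-1) => t; lra.
exists y => // z Mz; set c := inner _ _.
(* Moving [y] by [s c z] would come strictly closer to [x] unless [c = 0]; the [+ 1] covers [z = 0]
   without a case split. *)
pose s := (nrm z ^+ 2 + 1)^-1.
have z2 : 0 <= nrm z ^+ 2 by exact: sqr_ge0.
have s0 : 0 < s by rewrite invr_gt0 ltr_wpDl.
have := DE (s%:C * c *: z + y) (Ml _ _ _ Mz yM).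
move=> /(le_trans yD); rewrite opprD addrCA addrC.
rewrite -ler_sqr ?nnegrE ?nrm_ge0// (nrm_sqB (x - y)) nrmZ Normc.normcM normc_real ?(ltW s0)//.
rewrite innerZr -/c conjM conj_real -(mulrA s%:C) (mulrC (Num.conj c)) -normc_sq -rmorphM /=.
move=> h; apply: Normc.eq0_normc; apply/eqP; rewrite -sqrf_eq0.
have n0 := sqr_ge0 (Normc.normc c).
have E1 : s * (nrm z ^+ 2 + 1) = 1 by rewrite mulVf// gt_eqF// ltr_wpDl.
move: h n0; rewrite !exprMn; set C := Normc.normc c ^+ 2 => h n0.
have E2 : s ^+ 2 * C * nrm z ^+ 2 = s * C * (1 - s) by rewrite -E1; ring.
have h2 : C * (s * (1 + s)) <= 0 by move: h; rewrite E2; lra.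
by rewrite eq_le n0 andbT; move: h2; rewrite pmulr_lle0 // mulr_gt0 // addr_gt0.
Qed.

Lemma inner_inj x y : (forall z, inner z x = inner z y :> R[i]) -> x = y.
Proof.
move=> h; apply/eqP; rewrite -subr_eq0 -nrm_eq0 -sqrf_eq0 nrm_sq.
by rewrite innerBr h subrr.
Qed.

Lemma proj_exists M : closed_subspace M -> exists P : 'B(H),
  [/\ forall x, M (P x), forall x z, M z -> inner (x - P x) z = 0 :> R[i] &
      forall x, M x -> P x = x].
Proof.
move=> cM; have [M0 Ml _] := cM.
have ex x : {y | M y /\ forall z, M z -> inner (x - y) z = 0 :> R[i]}.
  by apply: cid; have [y] := proj_point x cM; exists y.
pose f x := sval (ex x).
have fM x : M (f x) by rewrite /f; case: (ex x) => ? [].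
have fo x z : M z -> inner (x - f x) z = 0 :> R[i] by rewrite /f; case: (ex x) => ? [? h] /h.
have un x y y' : M y -> M y' -> (forall z, M z -> inner (x - y) z = 0 :> R[i]) ->
    (forall z, M z -> inner (x - y') z = 0 :> R[i]) -> y = y'.
  move=> My My' h h'; apply/eqP; rewrite -subr_eq0 -nrm_eq0 -sqrf_eq0 nrm_sq.
  have Md : M (y - y') by rewrite addrC -scaleN1r; exact: Ml.
  have -> : inner (y - y') (y - y') = inner (x - y') (y - y') - inner (x - y) (y - y').
    by rewrite -innerBl opprB [x - y' + _]addrC subrKA.
  by rewrite h// h'// subrr.
have fl : linear f.
  move=> a x y; apply: un (fM _) (Ml _ _ _ (fM x) (fM y)) (fo _) _ => z Mz.
  by rewrite opprD addrACA -scalerBr innerDl innerZl !fo// mulr0 addr0.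
have fb x : nrm (f x) <= 1 * nrm x.
  rewrite mul1r -ler_sqr ?nnegrE ?nrm_ge0// -{2}(subrK (f x) x) nrm_sqD fo//.
  by rewrite mulr0 addr0 lerDr sqr_ge0.
have [P Pf] := mkbop fl fb; exists P; split=> [x|x z|x Mx]; rewrite Pf//; first exact: fo.
by apply: un (fM _) Mx (fo _) _ => z _; rewrite subrr inner0l.
Qed.

(** The vector [n = w - P w] is normal to the kernel of [f], and x - (f x / f n) n lies in that
    kernel; orthogonality of the two gives the formula. *)
Lemma riesz (f : H -> R[i]) (C : R) : (forall a x y, f (a *: x + y) = a * f x + f y) ->
  (forall x, Normc.normc (f x) <= C * nrm x) -> exists z, forall x, f x = inner x z.
Proof.
move=> fl fC; have f0 : f 0 = 0.
  by apply: (addrI (f 0)); have := fl 1 0 0; rewrite scale1r mul1r !addr0.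
have fB x y : f (x - y) = f x - f y by rewrite addrC -scaleN1r fl mulN1r addrC.
have [P [PM Po _]] : exists P : 'B(H), [/\ forall x, f (P x) = 0,
    forall x z, f z = 0 -> inner (x - P x) z = 0 :> R[i] & forall x, f x = 0 -> P x = x].
  apply: (@proj_exists [set x | f x = 0]); split=> //= [a x y xe ye|x h].
    by rewrite fl xe ye mulr0 addr0.
  apply: Normc.eq0_normc; apply/eqP; rewrite eq_le normc_ge0 andbT.
  apply: ler_eps => e e0; rewrite add0r.
  have Cp : 0 < `|C| + 1 by rewrite ltr_wpDl.
  have [y fy] := h (e / (`|C| + 1)) ltac:(by rewrite divr_gt0).
  rewrite ltr_pdivlMr// nrmBC => h1.
  have := fC (x - y); rewrite fB fy subr0 => /le_trans; apply.
  apply: le_trans (ltW h1); rewrite mulrC ler_wpM2l ?nrm_ge0//.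
  by rewrite (le_trans (ler_norm _))// lerDl.
have [fz|/existsNP[w /eqP fw]] := pselect (forall x, f x = 0).
  by exists 0 => x; rewrite fz inner0r.
pose n := w - P w; have fn : f n = f w by rewrite fB PM subr0.
have n0 : n != 0 by apply: contraNneq fw => n0; rewrite -fn n0 f0.
have nn : inner n n != 0 :> R[i].
  by rewrite nrm_inner (inj_eq (@complexI R)) sqrf_eq0 nrm_eq0.
exists (Num.conj (f n / inner n n) *: n) => x.
have := Po w (- (f x / f n) *: n + x).
rewrite fl mulNr divfK ?fn// addNr => /(_ erefl); rewrite -/n innerC.
move=> /(congr1 Num.conj); rewrite conjCK conjC0 innerDl innerZl innerZr conjCK.
move/eqP; rewrite mulNr addrC subr_eq0 => /eqP ->.
by move: (inner n n) nn => a a0; field; rewrite a0 fw.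
Qed.

(** Riesz representation of u |-> <A u, z> shows that the set behind [xget] in [adjoint] is
    inhabited. *)
Lemma inner_adjr A x y : inner (A x) y = inner x (adjoint A y) :> R[i].
Proof.
have [C C0 hC] := bop_bounded A.
have ex z : {w | forall x, inner (A x) z = inner x w :> R[i]}.
  apply/cid/(@riesz _ (C * nrm z)) => [a u v|u]; first by rewrite bop_linear innerDl innerZl.
  by rewrite (le_trans (cauchy_schwarz _ _))// mulrAC ler_wpM2r ?nrm_ge0.
pose f z := sval (ex z).
have fP z u : inner (A u) z = inner u (f z) :> R[i] by rewrite /f; case: (ex z).
suff [T Tf] : exists T : 'B(H), T =1 f.
  have : [set T : 'B(H) | forall x y, inner (A x) y = inner x (T y) :> R[i]] (adjoint A).
    by apply: (xgetPex 0); exists T => u v; rewrite fP Tf.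
  exact.
apply: (@mkbop _ C) => [a u v|u].
  by apply: inner_inj => z; rewrite innerDr innerZr -!fP innerDr innerZr.
have [->|fu] := eqVneq (f u) 0; first by rewrite nrm0 mulr_ge0 ?nrm_ge0// ltW.
have fp : 0 < nrm (f u) by rewrite nrm_gt0.
rewrite -(ler_pM2l fp) -expr2 nrm_sq -fP (le_trans (cauchy_schwarz_Re _ _))//.
by rewrite mulrCA mulrA ler_wpM2r ?nrm_ge0.
Qed.

Lemma inner_adjl A x y : inner (adjoint A x) y = inner x (A y) :> R[i].
Proof. by rewrite innerC -inner_adjr -innerC. Qed.

Lemma adjoint_uniq A T : (forall x y, inner (A x) y = inner x (T y) :> R[i]) -> adjoint A = T.
Proof. by move=> h; apply: bop_ext => y; apply: inner_inj => z; rewrite -inner_adjr. Qed.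

Lemma adjointK A : adjoint (adjoint A) = A.
Proof. by apply: adjoint_uniq => x y; rewrite inner_adjl. Qed.
Lemma adjointM A T : adjoint (A * T) = adjoint T * adjoint A.
Proof. by apply: adjoint_uniq => x y; rewrite !bopE !inner_adjr. Qed.
Lemma adjointD A T : adjoint (A + T) = adjoint A + adjoint T.
Proof. by apply: adjoint_uniq => x y; rewrite !bopE innerDl innerDr !inner_adjr. Qed.
Lemma adjointN A : adjoint (- A) = - adjoint A.
Proof. by apply: adjoint_uniq => x y; rewrite !bopE innerNl innerNr !inner_adjr. Qed.
Lemma adjointB A T : adjoint (A - T) = adjoint A - adjoint T.
Proof. by rewrite adjointD adjointN. Qed.
Lemma adjoint1 : adjoint 1 = 1 :> 'B(H).
Proof. exact: adjoint_uniq. Qed.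

End Operators.

(** * Square roots, inverses of coercive operators, polar decomposition *)

Section PolarDecomposition.
Context {R : realType} {H : hilbertType R}.
Implicit Types (x y z : H) (a b : R[i]) (A S T U : 'B(H)) (M : set H).

Lemma ler_nrm_dist x y : nrm x <= nrm y + nrm (x - y).
Proof. by rewrite -{1}(subrK y x) addrC ler_nrmD. Qed.

Lemma linB a x y z w : a *: x + y - (a *: z + w) = a *: (x - z) + (y - w).
Proof. by rewrite opprD addrACA scalerBr. Qed.

Lemma cvg_nrm_le (u : nat -> H) x (c : R) :
  (forall n, nrm (u n) <= c) -> u @ \oo --> x -> nrm x <= c.
Proof.
move=> h ux; apply: ler_eps => e e0; have [N hN] := cvgn_nrm ux e0.
have := ler_nrmB (u N) (u N - x); rewrite opprB addrC subrK.
by have := hN _ (leqnn N); have := h N; lra.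
Qed.

Lemma cvg_bop T (u : nat -> H) x : u @ \oo --> x -> (fun n => T (u n)) @ \oo --> T x.
Proof. by move=> ux; apply: continuous_cvg ux; have [_] := bopP T; apply. Qed.

Lemma sa_inner T x y : adjoint T = T -> inner (T x) y = inner x (T y) :> R[i].
Proof. by move=> {1}<-; rewrite inner_adjl. Qed.

Lemma adjointZr (r : R) A : adjoint (r%:C *: A) = r%:C *: adjoint A.
Proof.
apply: adjoint_uniq => x y.
by rewrite !scaleE innerZl innerZr conj_real inner_adjr.
Qed.

Lemma normc_opp a : Normc.normc (- a) = Normc.normc a.
Proof. by case: a => r s; rewrite /Normc.normc /= !sqrrN. Qed.

Lemma normcD a b : Normc.normc (a + b) <= Normc.normc a + Normc.normc b.
Proof. by have := ler_normD a b; rewrite !normc_def -rmorphD lecR; case: a b => [? ?] []. Qed.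

Lemma inner_lim (u v : nat -> H) x y z w : u @ \oo --> x -> v @ \oo --> y ->
  (forall n, inner (u n) z = inner w (v n) :> R[i]) -> inner x z = inner w y :> R[i].
Proof.
move=> ux vy uv; apply/eqP; rewrite -subr_eq0; apply/eqP/Normc.eq0_normc.
apply/eqP; rewrite eq_le normc_ge0 andbT; apply: ler_eps => e e0; rewrite add0r.
have Kp : 0 < nrm z + nrm w + 1 by rewrite ltr_wpDl// addr_ge0 ?nrm_ge0.
have d0 : 0 < e / (nrm z + nrm w + 1) by rewrite divr_gt0.
have [N hN] := cvgn_nrm ux d0; have [M hM] := cvgn_nrm vy d0.
have := hN _ (leq_maxl N M); have := hM _ (leq_maxr N M); set n := maxn N M.
rewrite !ltr_pdivlMr// => h1 h2.
have -> : inner x z - inner w y = inner w (v n - y) - inner (u n - x) z.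
  by rewrite innerBr innerBl -uv; ring.
rewrite (le_trans (normcD _ _))// normc_opp.
have := cauchy_schwarz w (v n - y); have := cauchy_schwarz (u n - x) z.
have := nrm_ge0 (v n - y); have := nrm_ge0 (u n - x).
have := nrm_ge0 z; have := nrm_ge0 w; move: (nrm _) h1 => r1 h1.
by nra.
Qed.

Lemma cvgn_unique (u : nat -> H) x y : u @ \oo --> x -> u @ \oo --> y -> x = y.
Proof. exact: cvg_unique. Qed.

Lemma mono_cauchy (t : nat -> R) (c : R) : (forall n, t n <= t n.+1) ->
  (forall n, t n <= c) -> forall d : R, 0 < d ->
  exists N, forall n, (N <= n)%N -> t n - t N < d.
Proof.
move=> tm tc d d0.
have st : has_sup (range t) by split; [exists (t 0%N); exists 0%N|exists c => _ [n _ <-]].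
have [_ [N _ <-] hN] := sup_adherent d0 st; exists N => n _.
by have := sup_upper_bound st (imageT t n); move: (sup _) hN => s hN hs; lra.
Qed.

Lemma ptw_limit (Y : nat -> 'B(H)) (C : R) :
  (forall x, exists y : H, (fun n => Y n x) @ \oo --> y) ->
  (forall n x, nrm (Y n x) <= C * nrm x) ->
  exists T : 'B(H), forall x, (fun n => Y n x) @ \oo --> T x.
Proof.
move=> /(_ _)/cid ex hC.
pose f x := sval (ex x); have fP x : (fun n => Y n x) @ \oo --> f x by rewrite /f; case: (ex x).
have [T Tf] : exists T : 'B(H), T =1 f.
  apply: (@mkbop _ _ _ C) => [a x y|x]; last exact: cvg_nrm_le (fP x).
  apply: (cvgn_unique (fP _)).
  have -> : (fun n => Y n (a *: x + y)) = (fun n => a *: Y n x + Y n y).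
    by apply/funext => n; rewrite bop_linear.
  by apply: cvgD; [apply: cvgZr|]; exact: fP.
by exists T => x; rewrite Tf.
Qed.

(** The bounded monotone [t] dominates the telescoped increments of [Y], so every orbit is Cauchy;
    starting from [Y 0 = 0] the same bound is uniform in [n]. *)
Lemma op_limit (Y : nat -> 'B(H)) (t : nat -> R) : Y 0%N = 0 ->
  (forall n x, nrm (Y n.+1 x - Y n x) <= (t n.+1 - t n) * nrm x) ->
  (forall n, t n <= t n.+1) -> (forall n, t n <= 1) ->
  exists T : 'B(H), forall x, (fun n => Y n x) @ \oo --> T x.
Proof.
move=> Y0 hY tm t1.
have tele m n x : (m <= n)%N -> nrm (Y n x - Y m x) <= (t n - t m) * nrm x.
  elim: n => [|n IH]; first by rewrite leqn0 => /eqP ->; rewrite !subrr nrm0 mul0r.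
  rewrite leq_eqVlt => /predU1P[->|mn]; first by rewrite !subrr nrm0 mul0r.
  rewrite -(subrKA (Y n x)) (le_trans (ler_nrmD _ _))//.
  by rewrite (le_trans (lerD (hY _ _) (IH mn)))// -mulrDl subrKA.
apply: (@ptw_limit _ (1 - t 0%N)) => [x|n x].
  apply: cauchy_nrm => e e0; have xp : 0 < nrm x + 1 by rewrite ltr_wpDl ?nrm_ge0.
  have [N hN] := mono_cauchy tm t1 (divr_gt0 e0 xp); exists N => n Nn.
  rewrite (le_lt_trans (tele _ _ _ Nn))//.
  have := hN n Nn; rewrite ltr_pdivlMr//; apply: le_lt_trans.
  rewrite ler_wpM2l ?lerDl// subr_ge0.
  by move/nondecreasing_seqP : tm; apply.
have := tele 0%N n x (leq0n n); rewrite Y0 subr0 => /le_trans; apply.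
by rewrite ler_wpM2r ?nrm_ge0// lerB.
Qed.

(** Polarization over complex scalars: reality of <T v, v> at v = x + y and at v = x + i y compares
    the imaginary and the real parts of <T x, y> and <T y, x>. *)
Lemma positive_adj T : positive_op T -> adjoint T = T.
Proof.
move=> Tp; apply: adjoint_uniq => x y.
have h1 := ger0_Im (Tp (x + y)); have h2 := ger0_Im (Tp (x + 'i%C *: y)).
have hx := ger0_Im (Tp x); have hy := ger0_Im (Tp y).
move: h1 h2; rewrite !bopD !bopZ !innerDl !innerDr !innerZl !innerZr [inner x (T y)]innerC.
move: hx hy; case: (inner (T x) x) => ? ?; case: (inner (T y) y) => ? ? /=.
case: (inner (T x) y) => p q; case: (inner (T y) x) => r s /= -> ->.
by move=> h1 h2; congr Complex; lra.
Qed.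

(** With [A1] a contraction proportional to [A], a fixed point T = (X + T^2) / 2 satisfies (1 - T)^2
    = 1 - X = [adjoint A1 * A1]; rescaling 1 - T by [C] gives the root. *)
Lemma sqrtop_exists A : exists T, positive_op T /\ T * T = adjoint A * A.
Proof.
have [C C0 hC] := bop_bounded A.
pose A1 : 'B(H) := C^-1%:C *: A; pose X : 'B(H) := 1 - adjoint A1 * A1.
have hA1 x : nrm (A1 x) <= nrm x.
  by rewrite bopE nrmZr ?invr_ge0 ?(ltW C0)// ler_pdivrMl.
have Xs : adjoint X = X by rewrite adjointB adjoint1 adjointM adjointK.
have hX x : nrm (X x) <= nrm x.
  rewrite -ler_sqr ?nnegrE ?nrm_ge0// subE nrm_sqB oneE mulE Re_innerC inner_adjl -nrm_sq.
  (* The expansion reads |x|^2 + |adjoint A1 (A1 x)|^2 - 2 |A1 x|^2, so it suffices that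
     [adjoint A1] does not increase the norm of [A1 x]. *)
  have : nrm (adjoint A1 (A1 x)) <= nrm (A1 x).
    have [->|w0] := eqVneq (adjoint A1 (A1 x)) 0; first by rewrite nrm0 nrm_ge0.
    have wp : 0 < nrm (adjoint A1 (A1 x)) by rewrite nrm_gt0.
    rewrite -(ler_pM2l wp) -expr2 nrm_sq inner_adjl (le_trans (cauchy_schwarz_Re _ _))//.
    by rewrite mulrC ler_wpM2r ?nrm_ge0.
  have := nrm_ge0 (adjoint A1 (A1 x)); have := nrm_ge0 (A1 x).
  by nra.
have XE x : X x = x - adjoint A1 (A1 x) by [].
clearbody X.
(* Y increases to 1 - sqrt (1 - X); the scalar iteration t for X = 1 dominates
   its increments, so it converges in norm without any spectral theory. *)
pose Y n : 'B(H) := iter n (fun Y => (2^-1)%:C *: (X + Y * Y)) 0.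
pose t n : R := iter n (fun t => 2^-1 * (1 + t ^+ 2)) 0.
have Y0 x : Y 0%N x = 0 by [].
have YS n x : Y n.+1 x = (2^-1)%:C *: (X x + Y n (Y n x)) by [].
have YZ : Y 0%N = 0 by [].
have t0 : t 0%N = 0 by [].
have tS n : t n.+1 = 2^-1 * (1 + t n ^+ 2) by [].
clearbody Y t.
(* Each [Y n] is a polynomial in [X]. The commutation obtained here lets the difference of the
   squares of [Y n.+1] and [Y n] factor below, as it does for the scalars [t]. *)
have Yc (Z : 'B(H)) n : (forall x, X (Z x) = Z (X x)) -> forall x, Y n (Z x) = Z (Y n x).
  move=> XZ; elim: n => [|n IH] x; first by rewrite !Y0 bop0.
  by rewrite !YS bopZ bopD XZ !IH.
have Ycc n m x : Y n (Y m x) = Y m (Y n x) by apply: (Yc) => z; rewrite (Yc X).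
have t01 n : 0 <= t n <= 1.
  elim: n => [|n /andP[h1 h2]]; rewrite ?t0 ?lexx ?ler01// tS.
  by apply/andP; split; nra.
have tm n : t n <= t n.+1 by have := t01 n; rewrite tS => /andP[]; nra.
have Yt n x : nrm (Y n x) <= t n * nrm x.
  elim: n x => [|n IH] x; first by rewrite Y0 nrm0 t0 mul0r.
  rewrite tS YS nrmZr ?invr_ge0// -mulrA ler_pM2l ?invr_gt0//.
  rewrite (le_trans (ler_nrmD _ _))// mulrDl mul1r lerD ?hX// expr2 -mulrA.
  by rewrite (le_trans (IH _))// ler_wpM2l//; case/andP: (t01 n).
have [T YT] : exists T : 'B(H), forall x, (fun n => Y n x) @ \oo --> T x.
  apply: (@op_limit _ t) => // [n x|n]; last by case/andP: (t01 n).
  elim: n x => [|n IH] x.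
    rewrite YS !Y0 tS t0 expr0n !addr0 !subr0 mulr1.
    by rewrite nrmZr ?invr_ge0// ler_wpM2l ?invr_ge0.
  have -> : Y n.+2 x - Y n.+1 x =
      (2^-1)%:C *: (Y n.+1 (Y n.+1 x - Y n x) + Y n (Y n.+1 x - Y n x)).
    rewrite !bopB (Ycc n.+1 n) subrKA (YS n.+1) [in RHS]scalerBr.
    by rewrite {2}(YS n x) -[LHS]scalerBr opprD addrACA subrr add0r scalerBr.
  rewrite nrmZr ?invr_ge0//.
  have Bn k : nrm (Y k (Y n.+1 x - Y n x)) <= t k * ((t n.+1 - t n) * nrm x).
    by rewrite (le_trans (Yt _ _))// ler_wpM2l//; case/andP: (t01 k).
  have -> : t n.+2 - t n.+1 = 2^-1 * ((t n.+1 + t n) * (t n.+1 - t n)).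
    by rewrite (tS n.+1) {2}(tS n); ring.
  rewrite -mulrA ler_pM2l ?invr_gt0// (le_trans (ler_nrmD _ _))//.
  by rewrite (le_trans (lerD (Bn _) (Bn _)))// -!mulrDl -mulrA.
have Tle x : nrm (T x) <= nrm x.
  apply: cvg_nrm_le (YT x) => n; rewrite (le_trans (Yt _ _))// ler_piMl ?nrm_ge0//.
  by case/andP: (t01 n).
have Ysa n : adjoint (Y n) = Y n.
  elim: n => [|n IH]; first by apply: adjoint_uniq => x y; rewrite !Y0 inner0l inner0r.
  apply: adjoint_uniq => x y; rewrite !YS innerZl innerZr conj_real.
  by rewrite innerDl innerDr !sa_inner.
have Tsa x y : inner (T x) y = inner x (T y) :> R[i].
  by apply: (inner_lim (YT x) (YT y)) => n; rewrite sa_inner.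
have TY x : T x = 2^-1%:C *: (X x + T (T x)).
  apply: (@cvgn_unique (fun n => Y n.+1 x)).
    by have := YT x; rewrite -(cvg_shiftS (fun n => Y n x)).
  under eq_fun do rewrite YS.
  apply: cvgZr; apply: cvgD; first exact: cvg_cst.
  apply/cvgn_nrmP => e e0; have e2 : 0 < e / 2 by rewrite divr_gt0.
  have [N hN] := cvgn_nrm (YT x) e2; have [M hM] := cvgn_nrm (YT (T x)) e2.
  exists (maxn N M) => n; rewrite geq_max => /andP[/hN h1 /hM h2].
  rewrite -(subrKA (Y n (T x))) -bopB (le_lt_trans (ler_nrmD _ _))//.
  have h3 : nrm (Y n (Y n x - T x)) <= nrm (Y n x - T x).
    rewrite (le_trans (Yt _ _))// ler_piMl ?nrm_ge0//; by case/andP: (t01 n).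
  by lra.
have TX x : X x = T x + T x - T (T x).
  have := congr1 (fun z => 2%:C *: z) (TY x).
  rewrite /= scalerA -rmorphM divff// scale1r rmorph_nat scaler_nat mulr2n => ->.
  by rewrite addrK.
have SX x : (1 - T) ((1 - T) x) = adjoint A1 (A1 x).
  have -> : adjoint A1 (A1 x) = x - X x by rewrite XE opprB addrC subrK.
  by rewrite !subE !oneE bopB TX !opprB opprD -addrA; congr (x + _); rewrite addrCA.
exists (C%:C *: (1 - T)); split.
  move=> x; rewrite scaleE innerZl mulr_ge0 ?lecR ?(ltW C0)// subE oneE innerBl.
  have : complex.Im (inner (T x) x) = 0.
    have := sa_inner x x (adjoint_uniq Tsa); rewrite [RHS]innerC.
    by case: (inner (T x) x) => r s [] /=; lra.
  have := cauchy_schwarz_Re (T x) x; rewrite nrm_inner; case: (inner (T x) x) => r s /= h ->.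
  rewrite lecE /= subr0 eqxx /= subr_ge0 (le_trans h)// expr2 ler_wpM2r ?nrm_ge0//.
apply: bop_ext => x; rewrite mulE !scaleE bopZ SX /A1 adjointZr !scaleE bopZ !scalerA.
by rewrite -!rmorphM mulfK ?gt_eqF// divff ?gt_eqF// scale1r.
Qed.

(** Lax-Milgram: coercivity bounds [T] below, hence [T] is injective with closed range, and a vector
    orthogonal to the range is orthogonal to its own image, so it vanishes. *)
Lemma coercive_inv T (c : R) : 0 < c ->
  (forall x, c * nrm x ^+ 2 <= complex.Re (inner (T x) x)) ->
  exists S, S * T = 1 /\ T * S = 1.
Proof.
move=> c0 hT.
have bb x : c * nrm x <= nrm (T x).
  have [->|x0] := eqVneq x 0; first by rewrite nrm0 mulr0 nrm_ge0.
  have xp : 0 < nrm x by rewrite nrm_gt0.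
  by rewrite -(ler_pM2r xp) -mulrA -expr2 (le_trans (hT x))// cauchy_schwarz_Re.
have inj x y : T x = T y -> x = y.
  move=> e; apply/eqP; rewrite -subr_eq0 -nrm_eq0 eq_le nrm_ge0 andbT.
  by have := bb (x - y); rewrite bopB e subrr nrm0 pmulr_rle0.
have cR : closed_subspace (range T).
  split; first by exists 0 => //; rewrite bop0.
    by move=> a _ _ [x _ <-] [y _ <-]; exists (a *: x + y) => //; rewrite bop_linear.
  move=> y hy.
  have ex n : {x | nrm (T x - y) < n.+1%:R^-1}.
    by apply: cid; have [|_ [x _ <-]] := hy n.+1%:R^-1; [rewrite invr_gt0|exists x].
  pose u n := sval (ex n); have hu n : nrm (T (u n) - y) < n.+1%:R^-1 by rewrite /u; case: (ex n).
  have Tu : (fun n => T (u n)) @ \oo --> y.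
    apply/cvgn_nrmP => e e0; have [N hN] := natSinv_lt e0; exists N => n /hN.
    exact: lt_trans.
  have [x ux] : exists x, u @ \oo --> x.
    apply: cauchy_nrm => e e0; have ce : 0 < c * e / 2 by rewrite divr_gt0 ?mulr_gt0.
    have [N hN] := cvgn_nrm Tu ce; exists N => n Nn.
    rewrite -(ltr_pM2l c0) (le_lt_trans (bb _))// bopB -(subrKA y).
    rewrite (le_lt_trans (ler_nrmD _ _))// (nrmBC y).
    by have := hN _ Nn; have := hN _ (leqnn N); lra.
  by exists x => //; exact: (cvgn_unique (cvg_bop ux) Tu).
have [P [PR Po _]] := proj_exists cR.
have sur y : {x | T x = y}.
  apply: cid; have [x _ Tx] := PR y; exists x; rewrite Tx.
  apply/eqP; rewrite -subr_eq0 -oppr_eq0 opprB -nrm_eq0 -sqrf_eq0 eq_le sqr_ge0 andbT.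
  rewrite -(pmulr_rle0 _ c0) (le_trans (hT _))//.
  by rewrite Re_innerC Po//; exists (y - P y).
pose f y := sval (sur y); have Tf y : T (f y) = y by rewrite /f; case: (sur y).
have [|y|S Sf] := @mkbop _ _ f c^-1.
- by move=> a x y; apply: inj; rewrite bop_linear !Tf.
- by rewrite ler_pdivlMl// (le_trans (bb _))// Tf.
exists S; split; apply: bop_ext => x; rewrite bopE Sf; first exact: inj.
exact: Tf.
Qed.


Lemma modulusP A : positive_op (modulus A) /\ modulus A * modulus A = adjoint A * A.
Proof.
have : [set T : 'B(H) | positive_op T /\ T * T = adjoint A * A] (modulus A).
  by apply: (xgetPex 0); exact: sqrtop_exists.
exact.
Qed.

Lemma modulus_sa A : adjoint (modulus A) = modulus A.
Proof. by apply: positive_adj; case: (modulusP A). Qed.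

Lemma nrm_modulus A x : nrm (modulus A x) = nrm (A x).
Proof.
apply/eqP; rewrite -(@eqrXn2 _ 2)// ?nrm_ge0// !nrm_sq sa_inner ?modulus_sa//.
by rewrite -mulE (modulusP A).2 mulE -inner_adjr.
Qed.

Lemma proj_sa (P : 'B(H)) : P * P = P ->
  (forall x y, inner (x - P x) (P y) = 0 :> R[i]) -> adjoint P = P.
Proof.
move=> PP Po; apply: adjoint_uniq => x y.
have h u v : inner u (P v) = inner (P u) (P v) :> R[i].
  by apply/eqP; rewrite -subr_eq0 -innerBl Po.
by rewrite h [LHS]innerC h -innerC.
Qed.

(* D is S T^-1 extended by continuity to the closure of the range of T, onto
   which P projects, and by 0 on the orthogonal complement. *)
Lemma douglas S T : (forall x, nrm (S x) <= nrm (T x)) ->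
  exists D P, [/\ D * T = S, orthogonal_projection P, P * T = T,
    forall y, (forall x, inner y (T x) = 0 :> R[i]) -> P y = 0 &
    (forall x, nrm (S x) = nrm (T x)) -> forall y, nrm (D y) = nrm (P y)].
Proof.
move=> ST.
pose M := [set y | forall e : R, 0 < e -> exists x, nrm (T x - y) < e].
have cM : closed_subspace M.
  split.
  - by move=> e e0; exists 0; rewrite bop0 subr0 nrm0.
  - move=> a x y Mx My e e0.
    have ap : 0 < Normc.normc a + 1 by rewrite ltr_wpDl ?normc_ge0.
    have [u hu] := Mx (e / 2 / (Normc.normc a + 1)) ltac:(by rewrite !divr_gt0).
    have [v hv] := My (e / 2) ltac:(by rewrite !divr_gt0).
    exists (a *: u + v); rewrite bop_linear linB (le_lt_trans (ler_nrmD _ _))//.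
    move: hu; rewrite nrmZ ltr_pdivlMr// => hu.
    by have := nrm_ge0 (T u - x); nra.
  - move=> x h e e0; have e2 : 0 < e / 2 by rewrite divr_gt0.
    have [y My hy] := h _ e2; have [u hu] := My _ e2.
    exists u; rewrite -(subrKA y) (le_lt_trans (ler_nrmD _ _))//; lra.
have [P [PM Po PI]] := proj_exists cM.
have MT x : M (T x) by move=> e e0; exists x; rewrite subrr nrm0.
(* [G] is the closure of the set of pairs (T x, S x). The bound [ST] passes to it as [Gle] and makes
   it single-valued, although [T] need not be injective. *)
pose G y z := forall e : R, 0 < e -> exists x, nrm (T x - y) < e /\ nrm (S x - z) < e.
have Gex y : M y -> exists z, G y z.
  move=> My.
  have ex n : {x | nrm (T x - y) < n.+1%:R^-1}.
    by apply: cid; apply: My; rewrite invr_gt0.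
  pose u n := sval (ex n); have hu n : nrm (T (u n) - y) < n.+1%:R^-1 by rewrite /u; case: (ex n).
  have [z uz] : exists z, (fun n => S (u n)) @ \oo --> z.
    apply: cauchy_nrm => e e0; have e2 : 0 < e / 2 by rewrite divr_gt0.
    have [N hN] := natSinv_lt e2; exists N => n Nn.
    rewrite -bopB (le_lt_trans (ST _))// bopB -(subrKA y) (le_lt_trans (ler_nrmD _ _))//.
    rewrite (nrmBC y); have := lt_trans (hu n) (hN _ Nn).
    by have := lt_trans (hu N) (hN _ (leqnn N)); lra.
  exists z => e e0; have [N hN] := natSinv_lt e0; have [K hK] := cvgn_nrm uz e0.
  exists (u (maxn N K)); rewrite hK ?leq_maxr// (lt_trans (hu _))// hN// leq_maxl//.
have Gle y z : G y z -> nrm z <= nrm y.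
  move=> Gyz; apply: ler_eps => e e0; have e2 : 0 < e / 2 by rewrite divr_gt0.
  have [x [h1 h2]] := Gyz _ e2; have := ST x.
  have := ler_nrm_dist z (S x); have := ler_nrm_dist (T x) y.
  by rewrite (nrmBC z); lra.
have Gl a x y z w : G x z -> G y w -> G (a *: x + y) (a *: z + w).
  move=> Gx Gy e e0.
  have ap : 0 < Normc.normc a + 1 by rewrite ltr_wpDl ?normc_ge0.
  have [u [hu hu']] := Gx (e / 2 / (Normc.normc a + 1)) ltac:(by rewrite !divr_gt0).
  have [v [hv hv']] := Gy (e / 2) ltac:(by rewrite !divr_gt0).
  exists (a *: u + v); rewrite !bop_linear !linB.
  move: hu hu'; rewrite !ltr_pdivlMr// => hu hu'.
  have := nrm_ge0 (T u - x); have := nrm_ge0 (S u - z); have n0 := normc_ge0 a.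
  by move=> ? ?; split; rewrite (le_lt_trans (ler_nrmD _ _))// nrmZ; nra.
have Gu y z w : G y z -> G y w -> z = w.
  move=> h1 h2; have := Gle _ _ (Gl (-1) _ _ _ _ h1 h2).
  rewrite !scaleN1r addNr nrm0 => h; apply/eqP; rewrite eq_sym -subr_eq0 -nrm_eq0.
  by rewrite eq_le nrm_ge0 andbT addrC.
have ex y : {z | G (P y) z} by apply: cid; apply: Gex.
pose f y := sval (ex y); have Gf y : G (P y) (f y) by rewrite /f; case: (ex y).
have Pc y : nrm (P y) <= nrm y.
  rewrite -ler_sqr ?nnegrE ?nrm_ge0// -{2}(subrK (P y) y) nrm_sqD Po//.
  by rewrite mulr0 addr0 lerDr sqr_ge0.
have [|y|D Df] := @mkbop _ _ f 1.
- by move=> a x y; apply: (Gu (P (a *: x + y))) => //; rewrite bop_linear; exact: Gl.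
- by rewrite mul1r (le_trans (Gle _ _ (Gf y))).
have PP : P * P = P by apply: bop_ext => x; rewrite mulE PI.
exists D, P; split.
- apply: bop_ext => x; rewrite mulE Df; apply: (Gu (T x)).
    by rewrite -{1}(PI (T x)).
  by move=> e e0; exists x; rewrite !subrr nrm0.
- by split=> //; apply: proj_sa => // x y; rewrite Po.
- by apply: bop_ext => x; rewrite mulE PI.
- move=> y hy; have P0 : inner (P y) (P y) = 0 :> R[i].
    apply: Normc.eq0_normc; apply/eqP; rewrite eq_le normc_ge0 andbT.
    apply: ler_eps => e e0; rewrite add0r.
    have yp : 0 < nrm y + 1 by rewrite ltr_wpDl ?nrm_ge0.
    have [x hx] := PM y (e / (nrm y + 1)) ltac:(by rewrite divr_gt0).
    have -> : inner (P y) (P y) = - inner y (T x - P y) :> R[i].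
      rewrite innerBr hy sub0r opprK; apply/eqP; rewrite eq_sym -subr_eq0 -innerBl Po//.
    rewrite normc_opp (le_trans (cauchy_schwarz _ _))//.
    move: hx; rewrite ltr_pdivlMr// => hx.
    by have := nrm_ge0 (T x - P y); nra.
  by apply/eqP; rewrite -nrm_eq0 -sqrf_eq0 nrm_sq P0.
- move=> iso y; rewrite Df; apply/eqP; rewrite eq_le Gle//=.
  apply: ler_eps => e e0; have e2 : 0 < e / 2 by rewrite divr_gt0.
  have [x [h1 h2]] := Gf y _ e2; have := iso x.
  have := ler_nrm_dist (P y) (T x); have := ler_nrm_dist (S x) (f y).
  by rewrite (nrmBC (P y)); lra.
Qed.

(** Factor [A] through [modulus A], isometrically since both have the same norms. The factor
    vanishes exactly where [P] does, on the complement of the range of |A|, which by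
    self-adjointness is N(|A|) = N(A). *)
Lemma polar_partP A :
  [/\ partial_isometry (polar_part A), A = polar_part A * modulus A &
    nullspace (polar_part A) = nullspace A].
Proof.
have : [set V : 'B(H) | [/\ partial_isometry V, A = V * modulus A &
    nullspace V = nullspace A]] (polar_part A); last exact.
apply: (xgetPex 0).
have [|D [P [DT [PP Pa] PT P0 Piso]]] := @douglas A (modulus A).
  by move=> x; rewrite nrm_modulus.
have iso := Piso (fun x => esym (nrm_modulus A x)).
have PPx x : P (P x) = P x by rewrite -mulE PP.
have DP x : D x = 0 <-> P x = 0.
  by split=> /eqP h; apply/eqP; move: h; rewrite -!nrm_eq0 iso.
exists D; split=> //.
  move=> x hx; rewrite !nrmE iso; suff -> : P x = x by [].
  apply/eqP; rewrite eq_sym -subr_eq0 -nrm_eq0 -sqrf_eq0 nrm_sq.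
  have N : P (x - P x) = 0 by rewrite bopB PPx subrr.
  rewrite innerBl hx ?sa_inner// ?N ?inner0r ?subrr//.
  by rewrite /nullspace /= DP.
apply/seteqP; split=> x; rewrite /nullspace /= DP => h.
  apply/eqP; rewrite -nrm_eq0 -nrm_modulus nrm_eq0; apply/eqP.
  apply: inner_inj => z; rewrite inner0r -sa_inner ?modulus_sa//.
  by rewrite -{1}PT mulE sa_inner// h inner0r.
apply: P0 => y; rewrite -sa_inner ?modulus_sa//.
have : nrm (modulus A x) = 0 by rewrite nrm_modulus h nrm0.
by move/eqP; rewrite nrm_eq0 => /eqP ->; rewrite inner0l.
Qed.

(* Factoring |T| = D2 T and T = D1 |T| gives T^* = |T| D1^* = D2 T D1^*. *)
Lemma op_ideal_adjoint (J : set 'B(H)) T : operator_ideal J -> J T -> J (adjoint T).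
Proof.
move=> [_ _ JM] JT.
have [|D1 [_ [E1 _ _ _ _]]] := @douglas T (modulus T); first by move=> x; rewrite nrm_modulus.
have [|D2 [_ [E2 _ _ _ _]]] := @douglas (modulus T) T; first by move=> x; rewrite nrm_modulus.
rewrite -E1 adjointM modulus_sa -E2 -mulrA.
by case: (JM D2 (T * adjoint D1)) => //; case: (JM (adjoint D1) T).
Qed.

End PolarDecomposition.

(** * Orthonormal sequences and bases *)

Section OrthonormalSequences.
Context {R : realType} {H : hilbertType R}.
Implicit Types (x y z : H) (a b : R[i]) (A K S T U : 'B(H)) (e f : nat -> H).

Lemma sum_natB (V : zmodType) (F : nat -> V) (m n : nat) : (m <= n)%N ->
  \sum_(0 <= i < n) F i - \sum_(0 <= i < m) F i = \sum_(m <= i < n) F i.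
Proof. by move=> mn; rewrite (@big_cat_nat _ _ _ m)//= [X in X - _]addrC addrK. Qed.

Lemma inner_suml (I : Type) (r : seq I) (P : pred I) (F : I -> H) z :
  inner (\sum_(i <- r | P i) F i) z = \sum_(i <- r | P i) inner (F i) z :> R[i].
Proof. by apply: (big_morph (fun x => inner x z)) => [x y|]; rewrite ?innerDl ?inner0l. Qed.

Lemma inner_sumr (I : Type) (r : seq I) (P : pred I) (F : I -> H) z :
  inner z (\sum_(i <- r | P i) F i) = \sum_(i <- r | P i) inner z (F i) :> R[i].
Proof. by apply: (big_morph (fun x => inner z x)) => [x y|]; rewrite ?innerDr ?inner0r. Qed.

Lemma rank1_exists u v : exists T : 'B(H), forall x, T x = inner x v *: u.
Proof.
apply: (@mkbop _ _ _ (nrm v * nrm u)) => [a x y|x].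
  by rewrite innerDl innerZl scalerDl scalerA.
by rewrite nrmZ mulrAC ler_wpM2r ?nrm_ge0// (mulrC (nrm v)) cauchy_schwarz.
Qed.

Definition rank1 u v : 'B(H) := sval (cid (rank1_exists u v)).

Lemma rank1E u v x : rank1 u v x = inner x v *: u.
Proof. by rewrite /rank1; case: cid. Qed.

Definition orthonormal_seq e := forall i j, inner (e i) (e j) = (i == j)%:R :> R[i].

Section Orthonormal.
Variables (e : nat -> H) (oe : orthonormal_seq e).

Lemma ons_nrm k : nrm (e k) = 1.
Proof. by apply/eqP; rewrite -(@eqrXn2 _ 2)// ?nrm_ge0// nrm_sq oe eqxx expr1n. Qed.

Lemma ons_inner (c : nat -> R[i]) n k :
  inner (\sum_(0 <= i < n) c i *: e i) (e k) = if (k < n)%N then c k else 0 :> R[i].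
Proof.
rewrite inner_suml; elim: n => [|n IH]; first by rewrite big_nil.
rewrite big_nat_recr//= IH innerZl oe ltnS.
by case: (ltngtP k n) => [||->]; rewrite ?mulr0 ?mulr1 ?addr0 ?add0r.
Qed.

Lemma ons_sum (c : nat -> R[i]) n :
  nrm (\sum_(0 <= i < n) c i *: e i) ^+ 2 = \sum_(0 <= i < n) Normc.normc (c i) ^+ 2.
Proof.
elim: n => [|n IH]; first by rewrite !big_nil nrm0 expr0n.
rewrite !big_nat_recr//= nrm_sqD IH innerZr ons_inner ltnn mulr0 mulr0 addr0.
by rewrite nrmZ ons_nrm mulr1.
Qed.

Definition eproj n : 'B(H) := \sum_(0 <= i < n) rank1 (e i) (e i).

Lemma eprojE n x : eproj n x = \sum_(0 <= i < n) inner x (e i) *: e i.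
Proof. by rewrite sumE; apply: eq_bigr => i _; rewrite rank1E. Qed.

Lemma eproj_inner n x k : inner (eproj n x) (e k) = if (k < n)%N then inner x (e k) else 0 :> R[i].
Proof. by rewrite eprojE ons_inner. Qed.

Lemma eproj_sa n : adjoint (eproj n) = eproj n.
Proof.
apply: adjoint_uniq => x y; rewrite !eprojE inner_suml inner_sumr.
by apply: eq_bigr => i _; rewrite innerZl innerZr -innerC mulrC.
Qed.

Lemma eproj_comp n m x : (n <= m)%N -> eproj n (eproj m x) = eproj n x.
Proof.
move=> nm; rewrite !eprojE; apply: eq_big_nat => i /andP[_ i_n].
by rewrite -eprojE eproj_inner (leq_trans i_n nm).
Qed.

Lemma eproj_compr n m x : (n <= m)%N -> eproj m (eproj n x) = eproj n x.
Proof.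
move=> nm; apply: inner_inj => z.
by rewrite -!sa_inner ?eproj_sa// eproj_comp.
Qed.

Lemma eproj_orth n x : inner (x - eproj n x) (eproj n x) = 0 :> R[i].
Proof. by rewrite innerBl (sa_inner x (eproj n x)) ?eproj_sa// eproj_comp// subrr. Qed.

Lemma eproj_pyth n x : nrm x ^+ 2 = nrm (x - eproj n x) ^+ 2 + nrm (eproj n x) ^+ 2.
Proof. by rewrite -[in LHS](subrK (eproj n x) x) (nrm_sqD (x - _)) eproj_orth mulr0 addr0. Qed.

Lemma eproj_le n x : nrm (eproj n x) <= nrm x.
Proof.
by rewrite -ler_sqr ?nnegrE ?nrm_ge0// [leRHS](eproj_pyth n) lerDr sqr_ge0.
Qed.

Lemma eproj_compl_le n x : nrm (x - eproj n x) <= nrm x.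
Proof.
by rewrite -ler_sqr ?nnegrE ?nrm_ge0// [leRHS](eproj_pyth n) lerDl sqr_ge0.
Qed.

Lemma bessel n x : \sum_(0 <= i < n) Normc.normc (inner x (e i)) ^+ 2 <= nrm x ^+ 2.
Proof. by rewrite -ons_sum -eprojE ler_sqr ?nnegrE ?nrm_ge0// eproj_le. Qed.

Lemma bessel_cauchy x (d : R) : 0 < d -> exists N, forall n, (N <= n)%N ->
  \sum_(N <= i < n) Normc.normc (inner x (e i)) ^+ 2 < d.
Proof.
move=> d0; have [|N hN] := mono_cauchy _ (bessel^~ x) d0.
  by move=> n; rewrite big_nat_recr//= lerDl sqr_ge0.
by exists N => n Nn; have := hN n Nn; rewrite sum_natB.
Qed.

(** Orthonormal sequences are weakly null; this drives the choice of almost orthogonal subsequences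
    in [ideal_ons]. *)
Lemma bessel0 x (d : R) : 0 < d ->
  exists N, forall n, (N <= n)%N -> Normc.normc (inner x (e n)) < d.
Proof.
move=> d0; have [N hN] := bessel_cauchy x (exprn_gt0 2 d0); exists N => n Nn.
have := hN n.+1 (leqW Nn); rewrite big_nat_recr//= => h.
rewrite -ltr_sqr ?nnegrE ?normc_ge0 ?ltW// (le_lt_trans _ h)// lerDr.
by apply: sumr_ge0 => i _; rewrite sqr_ge0.
Qed.

End Orthonormal.

Lemma isometry_exists e f : orthonormal_seq e -> orthonormal_seq f ->
  exists X : 'B(H), forall k, X (e k) = f k.
Proof.
move=> oe of_.
pose Y n : 'B(H) := \sum_(0 <= i < n) rank1 (f i) (e i).
have YE n x : Y n x = \sum_(0 <= i < n) inner x (e i) *: f i.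
  by rewrite sumE; apply: eq_bigr => i _; rewrite rank1E.
have [|n x|X XP] := @ptw_limit _ _ Y 1.
- move=> x; apply: cauchy_nrm => d d0.
  have [N hN] := bessel_cauchy oe x (exprn_gt0 2 d0); exists N => n Nn.
  rewrite -ltr_sqr ?nnegrE ?nrm_ge0 ?(ltW d0)// (le_lt_trans _ (hN _ Nn))//.
  rewrite !YE sum_natB//.
  (* Coefficients are padded with zeros below [N] because [ons_sum] speaks of sums starting at 0. *)
  pose c i := if (N <= i)%N then inner x (e i) else 0 : R[i].
  have -> : \sum_(N <= i < n) inner x (e i) *: f i = \sum_(0 <= i < n) c i *: f i.
    rewrite [RHS](@big_cat_nat _ _ _ N)//= [X in X + _]big1_seq ?add0r.
      by apply: eq_big_nat => i /andP[Ni _]; rewrite /c Ni.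
    move=> i /andP[_]; rewrite mem_index_iota /c (leqNgt N) => /andP[_ ->].
    by rewrite scale0r.
  rewrite ons_sum// (@big_cat_nat _ _ _ N)//= [X in X + _]big1_seq ?add0r.
    rewrite (@eq_big_nat _ _ _ _ _ _ (fun i => Normc.normc (inner x (e i)) ^+ 2))//.
    by move=> i /andP[Ni _]; rewrite /c Ni.
  move=> i /andP[_]; rewrite mem_index_iota /c (leqNgt N) => /andP[_ ->].
  by rewrite Normc.normc0 expr0n.
- rewrite mul1r -ler_sqr ?nnegrE ?nrm_ge0// YE ons_sum//; exact: bessel.
exists X => k; apply: (cvgn_unique (XP _)); apply/cvgn_nrmP => d d0; exists k.+1 => n kn.
suff -> : Y n (e k) = f k by rewrite subrr nrm0.
rewrite YE (bigD1_seq k) ?iota_uniq ?mem_index_iota//= oe eqxx scale1r.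
by rewrite big1 ?addr0// => i ik; rewrite oe eq_sym (negPf ik) scale0r.
Qed.

Section Basis.
Variables (e : nat -> H) (be : orthonormal_basis e).

Lemma basis_ons : orthonormal_seq e. Proof. by case: be. Qed.

Lemma basis_cvg x : (fun n => eproj e n x) @ \oo --> x.
Proof. by have [_ h] := be; under eq_fun do rewrite eprojE; exact: h. Qed.

Lemma basis_ext S T : (forall k, S (e k) = T (e k)) -> S = T.
Proof.
move=> h; apply: bop_ext => x; apply: (@cvgn_unique _ _ (fun n => S (eproj e n x))).
  exact/cvg_bop/basis_cvg.
have -> : (fun n => S (eproj e n x)) = (fun n => T (eproj e n x)).
  by apply/funext => n; rewrite eprojE !bop_sum; apply: eq_bigr => i _; rewrite !bopZ h.
exact/cvg_bop/basis_cvg.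
Qed.

Lemma basis_inner0 x : (forall k, inner x (e k) = 0 :> R[i]) -> x = 0.
Proof.
move=> h; apply: (@cvgn_unique _ _ (fun n => eproj e n x)); first exact: basis_cvg.
have -> : (fun n => eproj e n x) = (fun n => 0).
  by apply/funext => n; rewrite eprojE big1// => i _; rewrite h scale0r.
exact: cvg_cst.
Qed.

End Basis.

(** * Proper ideals: smallness along orthonormal sequences *)

Section ProperIdeals.
Variables (e : nat -> H) (be : orthonormal_basis e).
Variables (J : set 'B(H)) (JI : operator_ideal J) (J1 : ~ J 1).

Lemma op_ideal_mulr K T : J K -> J (K * T).
Proof. by move=> JK; have [_ _ h] := JI; case: (h T K JK). Qed.

Lemma op_ideal_mull K T : J K -> J (T * K).
Proof. by move=> JK; have [_ _ h] := JI; case: (h T K JK). Qed.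

(** Such a [K] would make [adjoint K * K] coercive, hence invertible, and 1 would be a multiple of a
    member of J. *)
Lemma no_bounded_below K (c : R) : J K -> 0 < c -> ~ (forall x, c * nrm x <= nrm (K x)).
Proof.
move=> JK c0 h; apply: J1.
have [x|S [<- _]] := @coercive_inv _ _ (adjoint K * K) (c ^+ 2) (exprn_gt0 2 c0).
  by rewrite mulE inner_adjl -nrm_sq -exprMn ler_sqr ?nnegrE ?nrm_ge0// mulr_ge0 ?nrm_ge0// ltW.
exact/op_ideal_mull/op_ideal_mull.
Qed.

Lemma lim_bound (u v : nat -> H) x y (c : R) : 0 < c -> u @ \oo --> x -> v @ \oo --> y ->
  (forall n, c * nrm (u n) <= nrm (v n)) -> c * nrm x <= nrm y.
Proof.
move=> c0 ux vy h; apply: ler_eps => d d0.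
have d1 : 0 < d / (c + 1) by rewrite divr_gt0// addr_gt0.
have [N hN] := cvgn_nrm ux d1; have [M hM] := cvgn_nrm vy d1.
have := hN _ (leq_maxl N M); have := hM _ (leq_maxr N M); have := h (maxn N M).
set n := maxn N M; rewrite !ltr_pdivlMr ?addr_gt0//.
have := ler_nrm_dist x (u n); have := ler_nrm_dist (v n) y; rewrite (nrmBC x).
have := nrm_ge0 (u n - x); have := nrm_ge0 (v n - y); nra.
Qed.

(* The bound on the cross terms is summable: altogether they cost at most half
   of the diagonal contribution d^2 B^2. *)
Lemma ons_bound (z : nat -> H) (d : R) : 0 < d -> (forall k, d <= nrm (z k)) ->
  (forall i j, (i < j)%N -> Normc.normc (inner (z i) (z j)) <= d ^+ 2 / 8 / 2 ^+ j / j.+1%:R) ->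
  forall (c : nat -> R[i]) (B : R), (forall k, Normc.normc (c k) <= B) -> forall n,
  d ^+ 2 * \sum_(0 <= i < n) Normc.normc (c i) ^+ 2 - d ^+ 2 / 2 * B ^+ 2 * (1 - (2 ^+ n)^-1)
    <= nrm (\sum_(0 <= i < n) c i *: z i) ^+ 2.
Proof.
move=> d0 dz zz c B cB; have B0 : 0 <= B by rewrite (le_trans (normc_ge0 (c 0%N))).
elim=> [|n IH].
  by rewrite !big_nil nrm0 expr0n expr0 invr1 subrr mulr0 mulr0 subrr.
rewrite !big_nat_recr//= nrm_sqD.
(* The factor [n.+1] in the hypothesis absorbs the [n] cross terms with [z n]. Doubled, the bound
   here is the amount by which d^2 / 2 B^2 (1 - 2^-n) grows from [n] to [n.+1]. *)
have E1 : - (d ^+ 2 / 8 / 2 ^+ n * B ^+ 2) <=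
    complex.Re (inner (\sum_(0 <= i < n) c i *: z i) (c n *: z n)).
  rewrite lerNl -raddfN -innerNl (le_trans (Re_le_normc _))// innerNl normc_opp.
  rewrite inner_suml.
  have -> : d ^+ 2 / 8 / 2 ^+ n * B ^+ 2 =
      \sum_(0 <= i < n.+1) (d ^+ 2 / 8 / 2 ^+ n / n.+1%:R * B ^+ 2).
    rewrite sumr_const_nat subn0 -[RHS]mulr_natr.
    have : n.+1%:R != 0 :> R by rewrite pnatr_eq0.
    by move: (n.+1%:R) (2 ^+ n)^-1 => M q M0; field.
  rewrite big_nat_recr//=.
  apply: (@le_trans _ _ (\sum_(0 <= i < n) (d ^+ 2 / 8 / 2 ^+ n / n.+1%:R * B ^+ 2))).
    set q := _ / n.+1%:R * _.
    suff aux m : (m <= n)%N -> Normc.normc (\sum_(0 <= i < m) inner (c i *: z i) (c n *: z n))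
        <= \sum_(0 <= i < m) q by exact: aux.
    elim: m => [|m IHm] mn; first by rewrite !big_nil Normc.normc0.
    rewrite !big_nat_recr//= (le_trans (normcD _ _))// lerD ?IHm ?(ltnW mn)//.
    rewrite innerZl innerZr !Normc.normcM.
    have -> : Normc.normc (Num.conj (c n)) = Normc.normc (c n).
      by rewrite /Normc.normc; case: (c n) => ? ? /=; rewrite sqrrN.
    rewrite /q; have := zz _ _ mn; have := cB m; have := cB n; move: (_ / _) => q'.
    have := normc_ge0 (c n); have := normc_ge0 (c m); have := normc_ge0 (inner (z m) (z n)).
    move: (Normc.normc _) (Normc.normc _) (Normc.normc _) => p r s p0 r0 s0 h1 h2 h3.
    rewrite mulrA mulrC ler_pM ?mulr_ge0// expr2 ler_pM//.
  by rewrite lerDl mulr_ge0 ?sqr_ge0// !divr_ge0 ?sqr_ge0// exprn_ge0.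
have E2 : d ^+ 2 * Normc.normc (c n) ^+ 2 <= nrm (c n *: z n) ^+ 2.
  by rewrite nrmZ exprMn mulrC ler_wpM2l ?sqr_ge0// ler_sqr ?nnegrE ?nrm_ge0// ltW.
have E3 : (2 ^+ n.+1)^-1 = 2^-1 * (2 ^+ n)^-1 :> R by rewrite exprS invfM.
rewrite E3; move: IH E1 E2; rewrite mulrDr; move: (2 ^+ n)^-1 => q.
move: (\sum_(0 <= i < n) Normc.normc _ ^+ 2) (nrm (\sum_(_ <= _ < _) _)) => s t.
by move: (complex.Re _) (Normc.normc _) (nrm _) => u v w; nra.
Qed.

(* A subsequence x o g has almost orthogonal images under K, so that K is bounded
   below on its span; hence K X is bounded below on H for the isometry
   X : e_k |-> x_(g k). *)
Lemma ideal_ons K (x : nat -> H) (d : R) : J K -> orthonormal_seq x -> 0 < d ->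
  ~ (forall k, d <= nrm (K (x k))).
Proof.
move=> JK ox d0 dK.
pose D j : R := d ^+ 2 / 8 / 2 ^+ j / j.+1%:R.
have D0 j : 0 < D j by rewrite !divr_gt0 ?exprn_gt0.
(* Weak nullity tested against [adjoint K (K (x m))], for the finitely many [m <= N], makes all late
   images almost orthogonal to the earlier ones. *)
have step j N : {k | (N < k)%N /\
    forall m, (m <= N)%N -> Normc.normc (inner (K (x m)) (K (x k))) <= D j}.
  apply: cid.
  suff [M hM] : exists M, forall k, (M <= k)%N -> forall m, (m <= N)%N ->
      Normc.normc (inner (K (x m)) (K (x k))) <= D j.
    exists (maxn M N.+1); rewrite leq_maxr; split=> // m; apply: hM; exact: leq_maxl.
  have one m : exists M, forall k, (M <= k)%N -> Normc.normc (inner (K (x m)) (K (x k))) <= D j.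
    have [M hM] := bessel0 ox (adjoint K (K (x m))) (D0 j); exists M => k /hM.
    by rewrite inner_adjl => /ltW.
  elim: N => [|N [M hM]].
    by have [M hM] := one 0%N; exists M => k /hM h m; rewrite leqn0 => /eqP ->.
  have [M' hM'] := one N.+1; exists (maxn M M') => k; rewrite geq_max => /andP[k1 k2] m.
  by rewrite leq_eqVlt => /predU1P[->|]; [exact: hM'|exact: hM].
pose g := fix g j := if j is i.+1 then sval (step j (g i)) else 0%N.
have gS j : (g j < g j.+1)%N /\ forall m, (m <= g j)%N ->
    Normc.normc (inner (K (x m)) (K (x (g j.+1)))) <= D j.+1.
  by rewrite /=; case: (step j.+1 (g j)).
have glt i j : (i < j)%N -> (g i < g j)%N.
  elim: j => // j IH; rewrite ltnS leq_eqVlt => /predU1P[->|/IH]; first by case: (gS j).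
  by move=> h; apply: ltn_trans h _; case: (gS j).
have ogx : orthonormal_seq (x \o g).
  move=> i j /=; rewrite ox; case: (ltngtP i j) => [ij|ij|->]; last by rewrite eqxx.
    by rewrite ltn_eqF ?glt.
  by rewrite gtn_eqF ?glt.
have [X XE] := isometry_exists (basis_ons be) ogx.
(* With B = [nrm w], [ons_bound] leaves at least d^2 / 2 times |w|^2, which exceeds the square of
   [d / 2] times |w|. *)
apply: (@no_bounded_below (K * X) (d / 2)); [exact: op_ideal_mulr|by rewrite divr_gt0|].
move=> y; apply: (@lim_bound (fun n => eproj e n y) (fun n => (K * X) (eproj e n y))).
- by rewrite divr_gt0.
- exact: basis_cvg.
- exact/cvg_bop/basis_cvg.
move=> n; set w := eproj e n y.
have oe := basis_ons be.
have := @ons_bound (fun k => K (x (g k))) d d0 (fun k => dK _) _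
  (fun k => inner w (e k)) (nrm w) _ n.
have -> : \sum_(0 <= i < n) inner w (e i) *: K (x (g i)) = (K * X) w.
  rewrite mulE -{2}[w](eproj_comp oe y (leqnn n)) -/w eprojE !bop_sum.
  by apply: eq_bigr => i _; rewrite !bopZ XE.
rewrite -(ons_sum oe) -eprojE eproj_comp// -/w => h.
rewrite -ler_sqr ?nnegrE ?nrm_ge0 ?mulr_ge0 ?nrm_ge0 ?divr_ge0 ?(ltW d0)//.
apply: le_trans (h _ _) => [|i j ij|k].
- have q0 : 0 <= (2 ^+ n)^-1 :> R by rewrite invr_ge0 exprn_ge0.
  have := sqr_ge0 (nrm w); have := sqr_ge0 d; rewrite exprMn expr_div_n.
  move: (d ^+ 2) (nrm w ^+ 2) => r s r0 s0; have := mulr_ge0 r0 s0.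
  by move=> rs; have := mulr_ge0 rs q0; lra.
- case: j ij => // j; rewrite ltnS => ij; have [_ /(_ (g i))] := gS j; apply.
  by move: ij; rewrite leq_eqVlt => /predU1P[->|/glt/ltnW].
- by rewrite (le_trans (cauchy_schwarz _ _))// ons_nrm// mulr1.
Qed.

(* Stands in for compactness of K: failure produces orthonormal vectors, in
   disjoint blocks of the basis, on which K does not tend to 0. *)
Lemma ideal_tail K (d : R) : J K -> 0 < d ->
  exists n, forall x, nrm (K (x - eproj e n x)) <= d * nrm x.
Proof.
move=> JK d0; apply: contrapT => /forallNP h.
have oe := basis_ons be.
have step n : {mv : nat * H | [/\ (n < mv.1)%N, nrm mv.2 = 1, eproj e n mv.2 = 0,
    eproj e mv.1 mv.2 = mv.2 & d <= nrm (K mv.2)]}.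
  apply: cid; have /existsNP[x /negP] := h n; rewrite -ltNge => hx.
  (* Strict inequality leaves room to cut the tail of [x] off at a finite [m], so that the new
     vector lives in the block of indices from [n] to [m]. *)
  have Kc : (fun m => K (eproj e m x - eproj e n x)) @ \oo --> K (x - eproj e n x).
    by apply: cvg_bop; apply: cvgB; [exact: basis_cvg|exact: cvg_cst].
  have g0 : 0 < nrm (K (x - eproj e n x)) - d * nrm x by rewrite subr_gt0.
  have [N hN] := cvgn_nrm Kc g0; pose m := maxn n.+1 N.
  have := hN m (leq_maxr _ _); set v := eproj e m x - eproj e n x => hv.
  have nm : (n < m)%N by exact: leq_maxl.
  have Kv : d * nrm x < nrm (K v).
    by have := ler_nrm_dist (K (x - eproj e n x)) (K v); rewrite nrmBC; lra.
  have vE : v = eproj e m (x - eproj e n x).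
    by rewrite bopB eproj_compr// ltnW.
  have vn : eproj e n v = 0.
    by rewrite vE (eproj_comp oe _ (ltnW nm)) bopB eproj_comp// subrr.
  have vm : eproj e m v = v by rewrite vE eproj_comp.
  have vx : nrm v <= nrm x by rewrite vE (le_trans (eproj_le _ _ _))// eproj_compl_le.
  have v0 : 0 < nrm v.
    rewrite nrm_gt0; apply: contraTneq Kv => ->; rewrite bop0 nrm0 -leNgt.
    by rewrite mulr_ge0 ?nrm_ge0// ltW.
  exists (m, (nrm v)^-1%:C *: v) => /=; split => //.
  - by rewrite nrmZr ?invr_ge0 ?nrm_ge0// mulVf ?gt_eqF.
  - by rewrite bopZ vn scaler0.
  - by rewrite bopZ vm.
  - rewrite bopZ nrmZr ?invr_ge0 ?nrm_ge0// ler_pdivlMl// mulrC (le_trans _ (ltW Kv))//.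
    by rewrite ler_wpM2l// ltW.
pose n := fix n j := if j is i.+1 then (sval (step (n i))).1 else 0%N.
pose v j := (sval (step (n j))).2.
have hv j : [/\ (n j < n j.+1)%N, nrm (v j) = 1, eproj e (n j) (v j) = 0,
    eproj e (n j.+1) (v j) = v j & d <= nrm (K (v j))] by rewrite /v /=; case: (step (n j)).
have nle i j : (i <= j)%N -> (n i <= n j)%N.
  elim: j => [|j IH]; first by rewrite leqn0 => /eqP ->.
  rewrite leq_eqVlt => /predU1P[-> //|/IH h']; apply: leq_trans h' _.
  by case: (hv j) => /ltnW.
have lt0 i j : (i < j)%N -> inner (v i) (v j) = 0 :> R[i].
  move=> ij; have [_ _ _ vi _] := hv i; have [_ _ vj _ _] := hv j.
  rewrite -vi -(eproj_compr oe _ (nle _ _ ij)) vi sa_inner ?eproj_sa// vj inner0r//.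
apply: (@ideal_ons K v d) => // [i j|k]; last by case: (hv k).
case: (ltngtP i j) => [/lt0 //|/lt0 h0|->].
  by rewrite innerC h0 conjC0.
by rewrite nrm_inner; case: (hv j) => _ -> _ _ _; rewrite expr1n.
Qed.

End ProperIdeals.

End OrthonormalSequences.

(** * Fredholm alternative modulo a proper ideal *)

Section FredholmAlternative.
Context {R : realType} {H : hilbertType R}.
Implicit Types (x y z : H) (a b : R[i]) (A F G K S T U : 'B(H)).

Section FiniteCoordinates.
Variables (e : nat -> H) (oe : orthonormal_seq e) (n : nat).

Definition coord x : 'cV[R[i]]_n := \col_j inner x (e j).
Definition lincomb (c : 'cV[R[i]]_n) : H := \sum_(i < n) c i 0 *: e i.

Lemma lincombD c d : lincomb (c + d) = lincomb c + lincomb d.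
Proof. by rewrite -big_split; apply: eq_bigr => i _; rewrite mxE scalerDl. Qed.

Lemma lincombN c : lincomb (- c) = - lincomb c.
Proof. by rewrite -sumrN; apply: eq_bigr => i _; rewrite mxE scaleNr. Qed.

Lemma lincombK c : coord (lincomb c) = c.
Proof.
apply/colP => j; rewrite mxE inner_suml (bigD1 j)//= innerZl oe eqxx mulr1.
by rewrite big1 ?addr0// => i ij; rewrite innerZl oe (negPf (_ : (i != j :> nat))) ?mulr0.
Qed.

Lemma coordK x : lincomb (coord x) = eproj e n x.
Proof. by rewrite eprojE big_mkord; apply: eq_bigr => i _; rewrite mxE. Qed.

Lemma coordD x y : coord (x + y) = coord x + coord y.
Proof. by apply/colP => j; rewrite !mxE innerDl. Qed.

Definition mx_op (A : 'M[R[i]]_n) : 'B(H) :=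
  \sum_(i < n) \sum_(j < n) A i j *: rank1 (e i) (e j).

Lemma mx_opE (A : 'M[R[i]]_n) x : mx_op A x = lincomb (A *m coord x).
Proof.
rewrite sumE; apply: eq_bigr => i _; rewrite sumE mxE scaler_suml.
by apply: eq_bigr => j _; rewrite scaleE rank1E scalerA mxE.
Qed.

Definition op_mx F : 'M[R[i]]_n := \matrix_(i, j) inner (F (e j)) (e i).

Lemma op_mxE F c : coord (F (lincomb c)) = op_mx F *m c.
Proof.
apply/colP => i; rewrite !mxE bop_sum inner_suml; apply: eq_bigr => j _.
by rewrite bopZ innerZl mxE mulrC.
Qed.

(* 1 + F E is invertible iff its compression to the span of e_0 .. e_(n-1), the
   matrix M below, is. *)
Lemma finite_rank_alt F :
  (exists S, S * (1 + F * eproj e n) = 1 /\ (1 + F * eproj e n) * S = 1) \/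
  (exists u v, [/\ u != 0, v != 0, (1 + F * eproj e n) u = 0 &
     forall x, inner ((1 + F * eproj e n) x) v = 0 :> R[i]]).
Proof.
pose M := 1%:M + op_mx F.
have [Mu|Mu] := boolP (M \in unitmx); [left|right].
  (* [Q] inverts the compression on the span and is 0 on its complement; 1 - F Q is the push-through
     formula (1 + F E)^-1 = 1 - F (1 + E F)^-1 E. *)
  pose Q := mx_op (invmx M); exists (1 - F * Q).
  have FEQ x : F (eproj e n (F (Q x))) = F (eproj e n x) - F (Q x).
    rewrite -bopB; congr (F _).
    rewrite -!coordK mx_opE op_mxE.
    rewrite -[op_mx F](addKr 1%:M) -/M mulmxDl mulNmx mul1mx mulmxA mulmxV// mul1mx.
    by rewrite lincombD lincombN addrC.
  have QFE x : Q (F (eproj e n x)) = eproj e n x - Q x.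
    rewrite -!coordK !mx_opE op_mxE.
    rewrite -[op_mx F](addKr 1%:M) -/M mulmxA mulmxDr mulmxN mulmx1 mulVmx// mulmxDl mul1mx mulNmx.
    by rewrite lincombD lincombN addrC.
  split; apply: bop_ext => x; rewrite !bopE.
    have -> : Q (x + F (eproj e n x)) = eproj e n x by rewrite bopD QFE addrC subrK.
    by rewrite addrK.
  have -> : F (eproj e n (x - F (Q x))) = F (Q x) by rewrite !bopB FEQ subKr.
  by rewrite subrK.
have Md : \det M == 0 by move: Mu; rewrite unitmxE unitfE negbK.
have /det0P[d d0 dM] := Md.
have /det0P[c c0 cM] : \det M^T == 0 by rewrite det_tr.
have Mc : op_mx F *m c^T = - c^T.
  apply/eqP; rewrite -addr_eq0 -{2}[c^T]mul1mx addrC -mulmxDl -/M.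
  by rewrite -(trmxK M) -trmx_mul cM trmx0.
(* Conjugated since [inner] is conjugate-linear on the right: pairing with [y] is then the row [d]
   applied to coordinates. *)
pose y := lincomb (map_mx Num.conj d^T).
have lincomb0 (w : 'cV_n) : lincomb w = 0 -> w = 0.
  by move=> h; rewrite -(lincombK w) h; apply/colP => j; rewrite !mxE inner0l.
(* By [Mc], the projection E of this vector is minus the combination given by [c]. Hence it is
   nonzero and F E sends it to its opposite. *)
exists (F (lincomb c^T)), y; split.
- apply: contraNneq c0 => h; have : coord (F (lincomb c^T)) = 0.
    by rewrite h; apply/colP => j; rewrite !mxE inner0l.
  rewrite op_mxE Mc => /eqP; rewrite oppr_eq0 => /eqP h'.
  by rewrite -(trmxK c) h' trmx0.
- apply: contraNneq d0 => /lincomb0 h; apply/eqP/rowP => j.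
  have := congr1 (fun w : 'cV_n => w j 0) h; rewrite !mxE => /eqP.
  by rewrite conjC_eq0 => /eqP.
- rewrite !bopE -coordK op_mxE Mc.
  by rewrite lincombN bopN addrN.
- move=> x; have -> : inner ((1 + F * eproj e n) x) y = (d *m coord ((1 + F * eproj e n) x)) 0 0.
    rewrite mxE inner_sumr; apply: eq_bigr => i _.
    by rewrite innerZr !mxE conjCK.
  rewrite !bopE coordD -coordK op_mxE -{1}[coord x]mul1mx -mulmxDl -/M mulmxA dM mul0mx.
  by rewrite mxE.
Qed.

End FiniteCoordinates.

Section Alternative.
Variables (e : nat -> H) (be : orthonormal_basis e).
Variables (J : set 'B(H)) (JI : operator_ideal J) (J1 : ~ J 1).

Lemma normalize x : x != 0 -> nrm ((nrm x)^-1%:C *: x) = 1.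
Proof.
rewrite -nrm_gt0 => x0.
by rewrite nrmZr ?invr_ge0 ?nrm_ge0// mulVf// gt_eqF.
Qed.

(** The tail K (1 - E) has norm at most 1/2, so [N] is coercive with constant 1/2 and invertible; G
    = N (1 + S K E) reduces to the finite rank case, and [adjoint S] carries the cokernel vector
    over to [G]. *)
Lemma fredholm_alternative G : J (G - 1) ->
  (exists S, S * G = 1 /\ G * S = 1) \/
  (exists u v, [/\ nrm u = 1, nrm v = 1, G u = 0 & adjoint G v = 0]).
Proof.
move=> JK; pose K : 'B(H) := G - 1.
have [n hn] := ideal_tail be JI J1 JK (ltac:(by rewrite invr_gt0) : (0 : R) < 2^-1).
pose N : 'B(H) := 1 + K * (1 - eproj e n).
have [|x|S [SN NS]] := @coercive_inv _ _ N 2^-1; first by rewrite invr_gt0.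
  have -> : N x = x + K (x - eproj e n x) by [].
  rewrite innerDl raddfD /= nrm_inner /=.
  have := cauchy_schwarz_Re (- (K (x - eproj e n x))) x; rewrite innerNl raddfN nrmN /=.
  have := hn x; rewrite -/K => /(ler_wpM2r (nrm_ge0 x)).
  by move: (complex.Re _) (nrm (K _)) (nrm x) => r s t /=; lra.
have GE : G = N * (1 + (S * K) * eproj e n).
  rewrite mulrDr mulr1 !mulrA NS mul1r /N mulrBr mulr1 -addrA subrK.
  by rewrite addrC subrK.
have [[T [T1 T2]]|[u [v [u0 v0 Gu Gv]]]] := finite_rank_alt (basis_ons be) n (S * K); [left|right].
  exists (T * S); rewrite GE; split.
    by rewrite -mulrA (mulrA S) SN mul1r.
  by rewrite mulrA -(mulrA N) T2 mulr1.
have w0 : adjoint S v != 0.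
  apply: contraNneq v0 => h; have := congr1 (fun T : 'B(H) => adjoint T v) SN.
  by rewrite /= adjointM mulE h bop0 adjoint1 oneE => <-.
exists ((nrm u)^-1%:C *: u), ((nrm (adjoint S v))^-1%:C *: adjoint S v); split.
- exact: normalize.
- exact: normalize.
- by rewrite bopZ GE mulE Gu bop0 scaler0.
- rewrite bopZ; suff -> : adjoint G (adjoint S v) = 0 by rewrite scaler0.
  apply: inner_inj => z; rewrite inner0r -!inner_adjr GE mulE -mulE SN oneE.
  exact: Gv.
Qed.

Hypothesis J0 : J <> [set 0].

(** A nonzero member of J, sandwiched between two rank one operators, yields any prescribed one. *)
Lemma ideal_rank1 u v : J (rank1 u v).
Proof.
have [T JT [x Tx]] : exists2 T, J T & exists x, T x != 0.
  apply: contrapT => h; apply: J0; apply/seteqP; split=> [T JT|T ->]; last by case: JI.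
  apply: bop_ext => x; apply/eqP/negPn/negP => Tx.
  by apply: h; exists T => //; exists x.
have -> : rank1 u v = rank1 ((nrm (T x) ^+ 2)^-1%:C *: u) (T x) * T * rank1 x v.
  apply: bop_ext => z; rewrite !mulE !rank1E bopZ innerZl nrm_inner !scalerA -mulrA.
  by rewrite -rmorphM divff ?mulr1// sqrf_eq0 nrm_eq0.
by apply: (op_ideal_mulr JI) => //; exact: (op_ideal_mull JI).
Qed.

Lemma op_idealD S T : J S -> J T -> J (S + T).
Proof. by case: JI => _ h _; exact: h. Qed.

Lemma op_idealN T : J T -> J (- T).
Proof. by move=> JT; rewrite -mulN1r; exact: (op_ideal_mull JI). Qed.

Lemma op_idealB S T : J S -> J T -> J (S - T).
Proof. by move=> JS /op_idealN; exact: op_idealD. Qed.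

(** * Extension of a partial isometry to a unitary in 1 + J *)

Section Extension.
Variables (p q Z : 'B(H)).
Hypotheses (Zp : adjoint Z * Z = p) (Zq : Z * adjoint Z = q)
  (ZpE : Z * p = Z) (qZ : q * Z = Z) (JZ : J (Z - p)).

Let pa : adjoint p = p. Proof. by rewrite -Zp adjointM adjointK. Qed.
Let qa : adjoint q = q. Proof. by rewrite -Zq adjointM adjointK. Qed.
Let pp : p * p = p. Proof. by rewrite -{1}Zp -mulrA ZpE. Qed.
Let qq : q * q = q. Proof. by rewrite -{2}Zq mulrA qZ. Qed.

(** Block form: [G] acts as [Z] on the range of [p] and, since q G (1 - p) = Z - Z p = 0, maps the
    null space of [p] into that of [q]. Only this second block is free to be corrected. *)
Let good G := [/\ J (G - 1), G * p = Z & q * G = Z].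

Lemma good_start : good (Z + (1 - q) * (1 - p)).
Proof.
have Jqp : J (q - p).
  have -> : q - p = (Z - p) * adjoint Z + adjoint (Z - p).
    have h : p * adjoint Z = adjoint Z by rewrite -{1}pa -adjointM ZpE.
    by rewrite mulrBl Zq h adjointB pa addrA subrK.
  by apply: op_idealD; [exact: (op_ideal_mulr JI)|exact: (op_ideal_adjoint JI)].
split.
- have -> : Z + (1 - q) * (1 - p) - 1 = (Z - p) - (q - p) * (1 - p).
    have -> : (q - p) * (1 - p) = q * (1 - p).
      by rewrite mulrBl [p * _]mulrBr mulr1 pp subrr subr0.
    rewrite mulrBl mul1r -!addrA; congr (Z + _).
    by rewrite addrC -!addrA addNr addr0.
  by apply: op_idealB => //; exact: (op_ideal_mulr JI).
- have e0 : (1 - p) * p = 0 by rewrite mulrBl mul1r pp subrr.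
  by rewrite mulrDl ZpE -mulrA e0 mulr0 addr0.
- have e0 : q * (1 - q) = 0 by rewrite mulrBr mulr1 qq subrr.
  by rewrite mulrDr qZ mulrA e0 mul0r addr0.
Qed.

(** Adding [rank1 v u] keeps the block form because [p u = 0] and [q v = 0]. As [v] is orthogonal to
    the range of [G], pairing [G' x = 0] with [v] isolates <x, u>. *)
Lemma good_step G : good G -> ~ (exists S, S * G = 1 /\ G * S = 1) ->
  exists G' u, [/\ good G', nrm u = 1, G u = 0 &
    forall x, G' x = 0 -> G x = 0 /\ inner x u = 0 :> R[i]].
Proof.
move=> [JG Gp qG] nG; have [//|[u [v [u1 v1 Gu Gv]]]] := fredholm_alternative JG.
have pu : p u = 0 by rewrite -Zp mulE -qG mulE Gu !bop0.
have qv : q v = 0.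
  have := congr1 (fun T : 'B(H) => adjoint T v) Gp.
  by rewrite /= adjointM mulE Gv bop0 -Zq mulE => <-; rewrite bop0.
exists (G + rank1 v u), u; split=> // [|x].
  split.
  - by rewrite addrAC; apply: op_idealD => //; exact: ideal_rank1.
  - apply: bop_ext => x; rewrite mulE addE rank1E (sa_inner _ _ pa) pu inner0r scale0r addr0.
    by rewrite -Gp mulE.
  - apply: bop_ext => x; rewrite mulE addE rank1E bopD bopZ qv scaler0 addr0.
    by rewrite -qG mulE.
rewrite addE rank1E => h.
have xu : inner x u = 0 :> R[i].
  have := congr1 (fun z => inner z v) h.
  by rewrite /= innerDl innerZl inner_adjr Gv inner0r add0r nrm_inner v1 expr1n mulr1 inner0l.
by move: h; rewrite xu scale0r addr0.
Qed.

(* Otherwise good_step could be iterated forever; the vectors u_k it removes from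
   the successive null spaces are orthonormal and G - 1 maps u_k to - u_k. *)
Lemma good_invertible : exists G, good G /\ exists S, S * G = 1 /\ G * S = 1.
Proof.
apply: contrapT => /forallNP h.
have st (G : {G | good G}) : {Gu : {G | good G} * H | [/\ nrm Gu.2 = 1, sval G Gu.2 = 0 &
    forall x, sval Gu.1 x = 0 -> sval G x = 0 /\ inner x Gu.2 = 0 :> R[i]]}.
  apply: cid; case: G => G gG.
  have [|G' [u [gG' u1 Gu hG]]] := good_step gG; first by move=> nG; apply: (h G).
  by exists (exist _ G' gG', u).
pose s n : {G | good G} := iter n (fun g => (sval (st g)).1) (exist good _ good_start).
pose u n := (sval (st (s n))).2.
have hs n : [/\ nrm (u n) = 1, sval (s n) (u n) = 0 & forall x, sval (s n.+1) x = 0 ->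
    sval (s n) x = 0 /\ inner x (u n) = 0 :> R[i]] by rewrite /u /=; case: (st (s n)).
have down i j x : (i <= j)%N -> sval (s j) x = 0 -> sval (s i) x = 0.
  elim: j => [|j IH]; first by rewrite leqn0 => /eqP ->.
  rewrite leq_eqVlt => /predU1P[-> //|/IH h'] h0; apply: h'.
  by case: (hs j) => _ _ /(_ x h0)[].
have lt0 i j : (i < j)%N -> inner (u j) (u i) = 0 :> R[i].
  move=> ij; have [_ _ hi] := hs i; have [_ uj _] := hs j.
  by have [] := hi _ (down _ _ _ ij uj).
have ou : orthonormal_seq u.
  move=> i j; case: (ltngtP i j) => [/lt0 h0|/lt0 //|->].
    by rewrite innerC h0 conjC0.
  by rewrite nrm_inner; case: (hs j) => -> _ _; rewrite expr1n.
have [JG _ _] := good_start.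
(* Null spaces only shrink along the iteration, so every [u k] is killed by the starting operator:
   one fixed member of J serves the whole sequence. *)
apply: (@ideal_ons _ _ _ be J JI J1 _ u 1 JG ou ltr01) => k.
have [uk sk _] := hs k; have := down 0%N k _ (leq0n k) sk.
by rewrite subE oneE => ->; rewrite sub0r nrmN uk.
Qed.

Lemma unitary_extension : exists2 U, unitary_ideal J U & U * p = Z.
Proof.
have [G [[JG Gp qG] [S [SG GS]]]] := good_invertible.
have [Mp MM] := modulusP G; have Ma := modulus_sa G; set M := modulus G in Mp MM Ma.
have S'G : adjoint S * adjoint G = 1 by rewrite -adjointM GS adjoint1.
have G'S : adjoint G * adjoint S = 1 by rewrite -adjointM SG adjoint1.
(* [S * adjoint S] inverts [adjoint G * G], the square of [M], so this product inverts [M]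
   itself. *)
pose Mi := M * (S * adjoint S).
have MMi : M * Mi = 1.
  by rewrite /Mi mulrA MM -mulrA (mulrA G) GS mul1r G'S.
have MiM : Mi * M = 1.
  suff E : Mi = S * adjoint S * M.
    by rewrite E -mulrA MM -mulrA (mulrA (adjoint S)) S'G mul1r SG.
  by rewrite -[RHS]mulr1 -MMi mulrA -(mulrA _ M M) MM -(mulrA S)
    (mulrA (adjoint S)) S'G mul1r SG mul1r.
have Mia : adjoint Mi = Mi.
  have E : adjoint Mi * M = 1 by rewrite -{1}Ma -adjointM MMi adjoint1.
  by rewrite -[LHS]mulr1 -MMi mulrA E mul1r.
have MiMi : Mi * Mi = S * adjoint S.
  by rewrite {2}/Mi mulrA MiM mul1r.
(* Inverting [M + 1] reduces statements on [M - 1] to its square: M - 1 = (M^2 - 1) Q, and M^2 - 1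
   lies in J. *)
have [x|Q [QM MQ]] := @coercive_inv _ _ (M + 1) 1 ltr01.
  rewrite addE oneE innerDl raddfD /= nrm_inner mul1r lerDr.
  by have := Mp x; rewrite lecE => /andP[].
have JG' : J (adjoint G - 1) by rewrite -adjoint1 -adjointB; exact: (op_ideal_adjoint JI).
have JM : J (M - 1).
  have -> : M - 1 = (adjoint G * (G - 1) + (adjoint G - 1)) * Q.
    transitivity ((M - 1) * ((M + 1) * Q)); first by rewrite MQ mulr1.
    rewrite mulrA; congr (_ * Q).
    by rewrite mulrDr mulr1 mulrBl mul1r MM mulrBr mulr1 !addrA !subrK.
  by apply: (op_ideal_mulr JI) => //; apply: op_idealD => //; exact: (op_ideal_mull JI).
(* U = G |G|^-1 *)
exists (G * Mi); first split; first split.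
- rewrite adjointM Mia -mulrA (mulrA (adjoint G)) -MM -mulrA MMi mulr1; exact: MiM.
- rewrite adjointM Mia mulrA -(mulrA G) MiMi -!mulrA S'G mulr1; exact: GS.
- have -> : G * Mi - 1 = ((G - 1) - (M - 1)) * Mi.
    by rewrite opprB addrA subrK mulrBl MMi.
  by apply: (op_ideal_mulr JI) => //; exact: op_idealB.
(* M^2 p = [adjoint G * Z] = [adjoint Z * Z] = p, so [M + 1] annihilates M p - p. *)
have Mpp : M * p = p.
  have E : M * (M * p) = p.
    rewrite mulrA MM -mulrA Gp -qZ mulrA.
    have -> : adjoint G * q = adjoint Z by rewrite -{1}qa -adjointM qG.
    exact: Zp.
  suff : (M + 1) * (M * p - p) = 0.
    move=> /(congr1 (fun T => Q * T)); rewrite mulrA QM mul1r mulr0 => /eqP.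
    by rewrite subr_eq0 => /eqP.
  by rewrite mulrBr !mulrDl !mul1r E [p + _]addrC subrr.
by rewrite -mulrA -{1}Mpp (mulrA Mi) MiM mul1r Gp.
Qed.

End Extension.
End Alternative.
End FredholmAlternative.

(** * Series in operator norm and the block singular value decomposition *)

Section BlockSVD.
Context {R : realType} {H : hilbertType R}.
Implicit Types (x y z : H) (a b l : R[i]) (A B D K S T U V : 'B(H)).

Lemma opnorm_le T (c : R) : 0 <= c -> (forall x, nrm (T x) <= c * nrm x) -> opnorm T <= c.
Proof.
move=> c0 h; apply: ge_sup; first by exists (nrm (T 0)); exists 0; rewrite //= normr0 ler01.
move=> _ [x /= x1 <-]; rewrite -/(nrm (T x)) (le_trans (h x))// ler_piMr//.
by rewrite -lecR -nrmE.
Qed.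

Lemma nrm_le_opnorm T x : nrm (T x) <= opnorm T * nrm x.
Proof.
have [C C0 hC] := bop_bounded T.
have [->|x0] := eqVneq x 0; first by rewrite bop0 !nrm0 mulr0.
have xp : 0 < nrm x by rewrite nrm_gt0.
rewrite -ler_pdivrMr// mulrC -nrmZr ?invr_ge0 ?nrm_ge0// -bopZ.
apply: ub_le_sup; last first.
  by exists ((nrm x)^-1%:C *: x) => //=; rewrite nrmE normalize.
exists C => _ [y /= y1 <-]; rewrite -/(nrm (T y)) (le_trans (hC y))// ler_piMr ?(ltW C0)//.
by rewrite -lecR -nrmE.
Qed.

Lemma opnorm_ge0 T : 0 <= opnorm T.
Proof.
have [C C0 hC] := bop_bounded T.
apply: (@le_trans _ _ (nrm (T 0))); first exact: nrm_ge0.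
apply: ub_le_sup; last by exists 0 => //=; rewrite normr0 ler01.
exists C => _ [y /= y1 <-]; rewrite -/(nrm (T y)) (le_trans (hC y))// ler_piMr ?(ltW C0)//.
by rewrite -lecR -nrmE.
Qed.

Section Series.
#[local] Existing Instance totally_filter.
Variable (I : choiceType).
Implicit Types (f : I -> 'B(H)) (F : {fset I}).

Lemma norm_series_cvgP f S : norm_series_cvg f S <->
  forall d : R, 0 < d -> exists F0 : {fset I}, forall F, (F0 `<=` F)%fset ->
    forall x, nrm (partial_sum f F x - S x) <= d * nrm x.
Proof.
split=> [/cvgrPdist_lt h d d0|h].
  have [F0 _ hF] := h d d0; exists F0 => F /hF; rewrite sub0r normrN.
  rewrite ger0_norm ?opnorm_ge0// => hd x.
  by rewrite -subE (le_trans (nrm_le_opnorm _ _))// ler_wpM2r ?nrm_ge0// ltW.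
apply/cvgrPdist_le => d d0; have [F0 hF] := h d d0; exists F0 => // F /hF h'.
by rewrite sub0r normrN ger0_norm ?opnorm_ge0// opnorm_le ?(ltW d0)// => x; rewrite subE.
Qed.

Lemma eq_norm_series f g S : f =1 g -> norm_series_cvg f S -> norm_series_cvg g S.
Proof. by move=> /funext ->. Qed.

Lemma partial_sumE f F x : partial_sum f F x = \sum_(i : F) f (val i) x.
Proof. by rewrite sumE. Qed.

Lemma norm_series_cvg_mulr f S T : norm_series_cvg f S ->
  norm_series_cvg (fun i => f i * T) (S * T).
Proof.
rewrite !norm_series_cvgP => h d d0; have [C C0 hC] := bop_bounded T.
have [F0 hF] := h (d / C) ltac:(by rewrite divr_gt0); exists F0 => F /hF h' x.
have -> : partial_sum (fun i => f i * T) F x = partial_sum f F (T x) by rewrite !partial_sumE.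
rewrite mulE (le_trans (h' _))// -mulrA ler_pM2l// mulrC ler_pdivrMr// mulrC.
by rewrite (le_trans (hC _))// mulrC.
Qed.

(** Allows the sum of a norm convergent series to be computed at vectors to which only finitely many
    blocks contribute. *)
Lemma norm_series_cvg_eq f S x z : norm_series_cvg f S ->
  (exists F1 : {fset I}, forall F, (F1 `<=` F)%fset -> partial_sum f F x = z) -> S x = z.
Proof.
rewrite norm_series_cvgP => h [F1 hF1]; apply/eqP; rewrite eq_sym -subr_eq0 -nrm_eq0.
rewrite eq_le nrm_ge0 andbT; apply: ler_eps => d d0; rewrite add0r.
have xp : 0 < nrm x + 1 by rewrite ltr_wpDl ?nrm_ge0.
have [F0 hF0] := h (d / (nrm x + 1)) ltac:(by rewrite divr_gt0).
have := hF0 (F0 `|` F1)%fset (fsubsetUl _ _) x; rewrite hF1 ?fsubsetUr// => /le_trans; apply.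
by rewrite mulrAC ler_pdivrMr// ler_wpM2l ?(ltW d0)// lerDl.
Qed.

End Series.

Section Polar.
Variable A : 'B(H).
Let M := modulus A.
Let V := polar_part A.

Lemma polar_modulus : V * M = A. Proof. by have [_ + _] := polar_partP A; move=> <-. Qed.

Lemma polar_modulusx x : V (M x) = A x. Proof. by rewrite -[in RHS]polar_modulus. Qed.

Lemma polar_null x : M x = 0 -> V x = 0.
Proof.
move=> Mx; have [_ _ N] := polar_partP A.
have : nullspace A x by rewrite /nullspace /=; apply/eqP; rewrite -nrm_eq0 -nrm_modulus Mx nrm0.
by rewrite -N.
Qed.

(** The defect [d] at [x] is killed by [M], hence by [V]; moving [V] and [M] across the inner
    product then gives <d, d> = 0. *)
Lemma polar_initial : adjoint V * V * M = M.
Proof.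
apply: bop_ext => x; apply/eqP; rewrite -subr_eq0; set d := _ - _.
have Md : M d = 0.
  have e1 : M * adjoint V = adjoint A by rewrite -polar_modulus adjointM modulus_sa.
  have e2 : M * (adjoint V * V * M) = M * M.
    by rewrite !mulrA e1 -mulrA polar_modulus -(modulusP A).2.
  by rewrite /d bopB -[M (_ x)]/((M * (adjoint V * V * M)) x) e2 subrr.
rewrite -nrm_eq0 -sqrf_eq0 nrm_sq {1}/d innerBl.
rewrite !mulE inner_adjl (polar_null Md) inner0r sa_inner ?modulus_sa// Md inner0r.
by rewrite subrr.
Qed.

Lemma polar_initialr : V * (adjoint V * V) = V.
Proof.
have h : M * (adjoint V * V) = M.
  have := congr1 adjoint polar_initial; rewrite !adjointM adjointK modulus_sa; exact.
apply: bop_ext => x; apply/eqP; rewrite mulE -subr_eq0 -bopB; apply/eqP/polar_null.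
by rewrite bopB -mulE h subrr.
Qed.

Lemma polar_final : adjoint V * (V * adjoint V) = adjoint V.
Proof. by have := congr1 adjoint polar_initialr; rewrite !adjointM adjointK mulrA. Qed.

End Polar.

Lemma eigenspace_closed T l : closed_subspace (Defs.eigenspace T l).
Proof.
split=> [|a x y|x h]; rewrite /Defs.eigenspace /=.
- by rewrite bop0 scaler0.
- by move=> hx hy; rewrite bop_linear hx hy scalerDr !scalerA mulrC.
have [C C0 hC] := bop_bounded (T - l *: bop_one H).
apply/eqP; rewrite -subr_eq0 -nrm_eq0 eq_le nrm_ge0 andbT; apply: ler_eps => d d0.
have [y Ty hy] := h (d / C) ltac:(by rewrite divr_gt0).
have := hC (x - y); rewrite bopB !subE !scaleE /= Ty subrr subr0 add0r => /le_trans; apply.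
by rewrite mulrC -ler_pdivlMr// nrmBC ltW.
Qed.

Lemma eigenprojectionP T l : orthogonal_projection (eigenprojection T l) /\
  range (eigenprojection T l) = Defs.eigenspace T l.
Proof.
have : [set P : 'B(H) | orthogonal_projection P /\ range P = Defs.eigenspace T l]
  (eigenprojection T l); last exact.
apply: (xgetPex 0); have [P [PM Po PI]] := proj_exists (eigenspace_closed T l).
have PP : P * P = P by apply: bop_ext => x; rewrite mulE PI.
exists P; split; first by split=> //; apply: proj_sa => // x y; rewrite Po.
by apply/seteqP; split=> [_ [x _ <-]|x hx]; [exact: PM|exists x; rewrite ?PI].
Qed.

Lemma eigen_orth T a b x y : adjoint T = T -> T x = a *: x -> T y = b *: y -> a != b ->
  inner x y = 0 :> R[i].
Proof.
move=> Ts Tx Ty ab; have [->|y0] := eqVneq y 0; first by rewrite inner0r.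
have bR : Num.conj b = b.
  have := sa_inner y y Ts; rewrite Ty innerZl innerZr => /esym/eqP.
  by rewrite (inj_eq (mulIf _)) ?nrm_inner ?(inj_eq (@complexI R)) ?sqrf_eq0 ?nrm_eq0// => /eqP.
have := sa_inner x y Ts; rewrite Tx Ty innerZl innerZr bR => /eqP.
by rewrite -subr_eq0 -mulrBl mulf_eq0 subr_eq0 (negPf ab) => /eqP.
Qed.

(** Entries 0 and 1 make [D] a self-adjoint idempotent. It is applied to what a partial sum of
    eigenprojections leaves of the initial projection. *)
Lemma diag_contraction (e : nat -> H) (c : nat -> bool) D : orthonormal_basis e ->
  (forall n, D (e n) = if c n then e n else 0) ->
  adjoint D = D /\ forall x, nrm (D x) <= nrm x.
Proof.
move=> be De; have oe := basis_ons be.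
have Ds : adjoint D = D.
  apply: (basis_ext be) => n; apply/eqP; rewrite -subr_eq0; apply/eqP.
  apply: (basis_inner0 be) => m; rewrite innerBl inner_adjl !De.
  have [->|nm] := eqVneq n m; first by case: (c m); rewrite ?inner0l ?inner0r subrr.
  by do 2 case: ifP => _; rewrite ?inner0l ?inner0r ?oe ?(negPf nm) subrr.
have DD : D * D = D.
  by apply: (basis_ext be) => n; rewrite mulE De; case: ifP => cn; rewrite ?De ?cn// bop0.
split=> // x; have [->|Dx] := eqVneq (D x) 0; first by rewrite nrm0 nrm_ge0.
have Dp : 0 < nrm (D x) by rewrite nrm_gt0.
rewrite -(ler_pM2l Dp) -expr2 nrm_sq sa_inner// -mulE DD (le_trans (cauchy_schwarz_Re _ _))//.
by rewrite mulrC.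
Qed.

(** * Series over the eigenvalues of a diagonalizable modulus *)

Section Diagonal.
Variables (A : 'B(H)) (e : nat -> H) (be : orthonormal_basis e).
Let M := modulus A.
Let V := polar_part A.
Let L := nonzero_point_spectrum M.
Variables (l : nat -> R[i]) (el : forall n, M (e n) = l n *: e n).

Lemma eigenprojection_basis a n : eigenprojection M a (e n) = if l n == a then e n else 0.
Proof.
have [[PP Pa] PR] := eigenprojectionP M a; set P := eigenprojection M a in PP Pa PR *.
have [la|la] := eqVneq (l n) a.
  have : range P (e n) by rewrite PR /Defs.eigenspace /= el la.
  by case=> z _ <-; rewrite -mulE PP.
have Pe : M (P (e n)) = a *: P (e n) by have : range P (P (e n)) by [exists (e n)]; rewrite PR.
apply/eqP; rewrite -nrm_eq0 -sqrf_eq0 nrm_sq sa_inner// -mulE PP.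
by rewrite (eigen_orth (modulus_sa A) (el n) Pe la).
Qed.

Lemma initial_basis n : (adjoint V * V) (e n) = if l n == 0 then 0 else e n.
Proof.
have [l0|l0] := eqVneq (l n) 0.
  by rewrite mulE (@polar_null A) ?bop0// -/M el l0 scale0r.
have -> : e n = M ((l n)^-1 *: e n) by rewrite bopZ el scalerA mulVf// scale1r.
by rewrite -mulE (polar_initial A).
Qed.

Lemma basis_neq0 n : e n != 0.
Proof. by rewrite -nrm_gt0 (ons_nrm (basis_ons be)). Qed.

Lemma basis_spectrum n : l n != 0 -> L (l n).
Proof. by move=> l0; split; [exists (e n); [exact: basis_neq0|exact: el]|exact/eqP]. Qed.

Let PF := partial_sum (fun a : L => eigenprojection M (val a)).

Lemma partial_basis (F : {fset L}) n :
  PF F (e n) = if [exists i : F, val (val i) == l n] then e n else 0.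
Proof.
rewrite partial_sumE; case: ifPn => [/existsP[i /eqP il]|/existsPn h].
  rewrite (bigD1 i)//= big1 ?addr0 => [|j ji]; first by rewrite eigenprojection_basis il eqxx.
  rewrite eigenprojection_basis ifN//; apply: contraNneq ji => lj.
  by apply/eqP/val_inj/val_inj; rewrite il lj.
by rewrite big1// => i _; rewrite eigenprojection_basis ifN// eq_sym.
Qed.

(** Translates initial segments of the basis, in which [ideal_tail] is phrased, into finite sets of
    eigenvalues, which index the net of partial sums. *)
Lemma spectrum_cover n : exists F0 : {fset L}, forall F, (F0 `<=` F)%fset ->
  forall k, (k < n)%N -> l k != 0 -> [exists i : F, val (val i) == l k].
Proof.
elim: n => [|n [F0 hF0]]; first by exists fset0.
have [l0|l0] := eqVneq (l n) 0.
  exists F0 => F /hF0 h k; rewrite ltnS leq_eqVlt => /predU1P[->|/h //].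
  by rewrite l0 eqxx.
pose ln : L := SigSub (mem_set (basis_spectrum l0)).
exists (ln |` F0)%fset => F; rewrite fsubUset fsub1set => /andP[lF /hF0 h] k.
rewrite ltnS leq_eqVlt => /predU1P[-> _|/h //].
by apply/existsP; exists [` lF]%fset.
Qed.

Variables (J : set 'B(H)) (JI : operator_ideal J) (J1 : ~ J 1).

(** Once [F] contains the nonzero eigenvalues of the first [n] basis vectors, the remainder [D] is a
    projection diagonal in [e] that vanishes on them; its values lie in the tail, where [K] is
    small. *)
Lemma eigenprojection_series K : J K ->
  norm_series_cvg (fun a : L => K * eigenprojection M (val a)) (K * (adjoint V * V)).
Proof.
move=> JK; apply/norm_series_cvgP => d d0.
have [n hn] := ideal_tail be JI J1 JK d0; have [F0 hF0] := spectrum_cover n.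
exists F0 => F /hF0 hF x.
pose D : 'B(H) := adjoint V * V - PF F.
pose c k := (l k != 0) && ~~ [exists i : F, val (val i) == l k].
have De k : D (e k) = if c k then e k else 0.
  rewrite /D subE initial_basis partial_basis /c; have [l0|l0] /= := eqVneq (l k) 0.
    case: existsP => [[i /eqP il]|_]; last by rewrite subrr.
    by have [_ /=] := set_mem (valP (val i)); rewrite il l0.
  by case: existsP => _ /=; rewrite ?subrr ?subr0.
have [Ds Dc] := diag_contraction be De.
have -> : partial_sum (fun a : L => K * eigenprojection M (val a)) F x - (K * (adjoint V * V)) x
    = - K (D x).
  have -> : partial_sum (fun a : L => K * eigenprojection M (val a)) F x = K (PF F x).
    by rewrite !partial_sumE bop_sum.
  by rewrite /D subE bopB opprB.
have ED : eproj e n (D x) = 0.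
  rewrite eprojE big_nat big1// => k /andP[_ kn].
  rewrite sa_inner// De /c; case: ifP; rewrite ?inner0r ?scale0r// => /andP[l0].
  by rewrite hF.
rewrite nrmN -[D x]subr0 -ED (le_trans (hn _))// ler_pM2l//.
Qed.

End Diagonal.

(** As [a] is nonzero, the eigenspace lies in the range of |A|, where the initial projection of the
    polar part is the identity. *)
Lemma bsvd_initial A a : nonzero_point_spectrum (modulus A) a ->
  adjoint (bsvd_part A a) * bsvd_part A a = eigenprojection (modulus A) a.
Proof.
move=> [_ /= /eqP a0]; have [[PP Pa] PR] := eigenprojectionP (modulus A) a.
rewrite /bsvd_part adjointM Pa -mulrA (mulrA (adjoint _)).
set P := eigenprojection _ _ in PP Pa PR *.
suff -> : adjoint (polar_part A) * polar_part A * P = P by [].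
apply: bop_ext => x; rewrite mulE.
have MP : modulus A (P x) = a *: P x by have : range P (P x) by [exists x]; rewrite PR.
have -> : P x = modulus A (a^-1 *: P x) by rewrite bopZ MP scalerA mulVf// scale1r.
by rewrite -mulE polar_initial.
Qed.

(** Eliminates the polar part, so that W_a = U V_a follows from [U * A = B] and equality of the
    moduli alone. *)
Lemma bsvd_partE A a x : a != 0 ->
  bsvd_part A a x = a^-1 *: A (eigenprojection (modulus A) a x).
Proof.
move=> a0; have [[PP Pa] PR] := eigenprojectionP (modulus A) a.
set P := eigenprojection _ _ in PP Pa PR *.
have MP : modulus A (P x) = a *: P x by have : range P (P x) by [exists x]; rewrite PR.
by rewrite -(polar_modulusx A (P x)) MP bopZ scalerA mulVf// scale1r.
Qed.

(** * The two implications *)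

Section Equivalence.
Variables (A B : 'B(H)) (J : set 'B(H)) (JP : proper_operator_ideal J).
Variables (e : nat -> H) (be : orthonormal_basis e) (l : nat -> R[i]).
Hypothesis el : forall n, modulus A (e n) = l n *: e n.
Let L := nonzero_point_spectrum (modulus A).
Let JI : operator_ideal J. Proof. by case: JP. Qed.
Let J0 : J <> [set 0]. Proof. by case: JP. Qed.
Let J1 : ~ J 1.
Proof.
move=> h; case: JP => _ _; apply; apply/seteqP; split=> // T _.
by rewrite -(mulr1 T); exact: (op_ideal_mull JI).
Qed.

Lemma unitary_modulus U : adjoint U * U = 1 -> modulus (U * A) = modulus A.
Proof. by move=> UU; rewrite /modulus adjointM -mulrA (mulrA (adjoint U)) UU mul1r. Qed.

Lemma unitary_series U : unitary_ideal J U -> U * A = B ->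
  (exists2 S, J S & norm_series_cvg (fun a : L => (bsvd_part B (val a) - bsvd_part A (val a))
     * adjoint (bsvd_part A (val a))) S) /\
  (exists2 S, J S & norm_series_cvg (fun a : L => (bsvd_part A (val a) - bsvd_part B (val a))
     * adjoint (bsvd_part B (val a))) S).
Proof.
move=> [[UU _] JU] UA; have MB : modulus B = modulus A by rewrite -UA unitary_modulus.
have W a : L a -> bsvd_part B a = U * bsvd_part A a.
  move=> [_ /= /eqP a0]; apply: bop_ext => x.
  by rewrite mulE !bsvd_partE// MB -UA mulE bopZ.
set V := polar_part A.
have f1 (a : L) : (bsvd_part B (val a) - bsvd_part A (val a)) * adjoint (bsvd_part A (val a))
    = (U - 1) * V * eigenprojection (modulus A) (val a) * adjoint V.
  have [[PP Pa] _] := eigenprojectionP (modulus A) (val a).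
  rewrite W; last exact: set_mem (valP a).
  rewrite -[X in _ - X]mul1r -mulrBl /bsvd_part adjointM Pa -/V !mulrA.
  by congr (_ * adjoint V); rewrite -[LHS]mulrA PP.
(* Since W_a = U V_a, the second term is the first one multiplied on the right by [- adjoint U]. *)
have f2 (a : L) : (bsvd_part A (val a) - bsvd_part B (val a)) * adjoint (bsvd_part B (val a))
    = (U - 1) * V * eigenprojection (modulus A) (val a) * (adjoint V * - adjoint U).
  have La := set_mem (valP a).
  by rewrite mulrA -f1 (W _ La) adjointM mulrN -[RHS]mulNr -[in RHS]mulNr opprB mulrA.
have JK : J ((U - 1) * V) by exact: op_ideal_mulr.
have sK := eigenprojection_series be el JI J1 JK.
have := norm_series_cvg_mulr (adjoint V) sK.
have := norm_series_cvg_mulr (adjoint V * - adjoint U) sK.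
move=> s2 s1; split.
  exists ((U - 1) * V * (adjoint V * V) * adjoint V).
    by apply: op_ideal_mulr => //; exact: op_ideal_mulr.
  by apply: eq_norm_series s1 => a; rewrite f1.
exists ((U - 1) * V * (adjoint V * V) * (adjoint V * - adjoint U)).
  by apply: op_ideal_mulr => //; exact: op_ideal_mulr.
by apply: eq_norm_series s2 => a; rewrite f2.
Qed.

(** For nonzero [a] the initial projections are eigenprojections, so the eigenspaces agree. If |A|
    kills [e n], then |B| (e n) is orthogonal to every [f k]: either |B| kills [f k], or [f k] is an
    eigenvector of |A| for a nonzero eigenvalue. *)
Lemma modulus_eq : diagonalizable_op (modulus B) ->
  point_spectrum (modulus B) = point_spectrum (modulus A) ->
  (forall a, L a -> adjoint (bsvd_part A a) * bsvd_part A a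
     = adjoint (bsvd_part B a) * bsvd_part B a) ->
  modulus B = modulus A.
Proof.
move=> [f bf /(_ _)/cid fB] sp PV.
have PE a : L a -> eigenprojection (modulus B) a = eigenprojection (modulus A) a.
  move=> La; rewrite -(bsvd_initial La) PV// bsvd_initial//.
  by rewrite /nonzero_point_spectrum sp.
have EE a : L a -> Defs.eigenspace (modulus B) a = Defs.eigenspace (modulus A) a.
  move=> /PE; rewrite -(eigenprojectionP (modulus B) a).2.
  by rewrite -(eigenprojectionP (modulus A) a).2 => ->.
apply: (basis_ext be) => n; have [l0|l0] := eqVneq (l n) 0; last first.
  have Ll := basis_spectrum be el l0.
  have : Defs.eigenspace (modulus B) (l n) (e n) by rewrite EE// /Defs.eigenspace /= el.
  by rewrite /Defs.eigenspace /= el.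
rewrite el l0 scale0r; apply: (basis_inner0 bf) => k.
have [m hm] := fB k; rewrite sa_inner ?modulus_sa// hm innerZr.
have [->|m0] := eqVneq m 0; first by rewrite conjC0 mul0r.
have fk0 : f k != 0 := basis_neq0 bf k.
have Lm : L m by split; [rewrite /= -sp; exists (f k)|exact/eqP].
have Afk : modulus A (f k) = m *: f k by have : Defs.eigenspace (modulus A) m (f k) by rewrite -EE.
by rewrite (eigen_orth (modulus_sa A) (el n) Afk) ?mulr0// l0 eq_sym.
Qed.

Lemma series_unitary S : modulus B = modulus A -> J S ->
  norm_series_cvg (fun a : L => (bsvd_part B (val a) - bsvd_part A (val a))
     * adjoint (bsvd_part A (val a))) S ->
  exists2 U, unitary_ideal J U & U * A = B.
Proof.
move=> MB JS cS; pose V := polar_part A; pose W := polar_part B.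
have elB n : modulus B (e n) = l n *: e n by rewrite MB.
have VW : adjoint W * W = adjoint V * V.
  by apply: (basis_ext be) => n; rewrite (initial_basis elB) (initial_basis el).
have V1 : V * (adjoint V * V) = V by exact: polar_initialr.
have W1 : W * (adjoint V * V) = W by rewrite -VW; exact: polar_initialr.
have V2 : adjoint V * (V * adjoint V) = adjoint V by exact: polar_final.
have fE (a : L) x : ((bsvd_part B (val a) - bsvd_part A (val a)) * adjoint (bsvd_part A (val a))) x
    = (W - V) (eigenprojection (modulus A) (val a) (adjoint V x)).
  have [[PP Pa] _] := eigenprojectionP (modulus A) (val a).
  have PPx y : eigenprojection (modulus A) (val a) (eigenprojection (modulus A) (val a) y)
      = eigenprojection (modulus A) (val a) y by rewrite -mulE PP.
  by rewrite /bsvd_part MB adjointM Pa !(mulE, subE) !PPx.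
(* [e] is adapted to the initial side of [V], while the series acts on its final side; hence the
   evaluation at [V (e n)], where at most one term survives. Taking [n.+1] below covers the index
   [n] itself. *)
have SV : S * V = (W - V) * (adjoint V * V).
  apply: (basis_ext be) => n; rewrite !mulE; apply: (norm_series_cvg_eq cS).
  have [F0 hF0] := spectrum_cover be el n.+1; exists F0 => F /hF0 hF.
  rewrite partial_sumE.
  under eq_bigr do rewrite fE.
  have -> : adjoint V (V (e n)) = if l n == 0 then 0 else e n.
    by rewrite -(initial_basis el n).
  rewrite -bop_sum; congr ((W - V) _); have [l0|l0] := eqVneq (l n) 0.
    by rewrite big1// => a _; rewrite bop0.
  by have := partial_basis el F n; rewrite partial_sumE hF.
have SE : S = W * adjoint V - V * adjoint V.
  apply: bop_ext => x; pose w := x - V (adjoint V x).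
  have V2x y : adjoint V (V (adjoint V y)) = adjoint V y by rewrite -[in RHS]V2.
  (* [w] is the component of [x] in the null space of [adjoint V], where every term of the series
     vanishes. *)
  have Sw : S w = 0.
    apply: (norm_series_cvg_eq cS); exists fset0 => F _.
    by rewrite partial_sumE big1// => a _; rewrite fE bopB V2x subrr !bop0.
  have SVx y : S (V y) = (W - V) (adjoint V (V y)) by have := congr1 (fun T : 'B(H) => T y) SV.
  by rewrite -{1}[x](subrK (V (adjoint V x))) -/w bopD Sw add0r SVx V2x.
have [|||||U JU Up] := @unitary_extension _ _ e be J JI J1 J0 (V * adjoint V)
    (W * adjoint W) (W * adjoint V).
- by rewrite adjointM adjointK mulrA -(mulrA V) VW V1.
- by rewrite adjointM adjointK mulrA -(mulrA W) W1.
- by rewrite -mulrA V2.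
- by rewrite mulrA -(mulrA W) VW W1.
- by rewrite -SE.
exists U => //; rewrite -(polar_modulus A) -(polar_modulus B) -/V -/W MB.
have VM : adjoint V * V * modulus A = modulus A by exact: polar_initial.
transitivity (U * (V * adjoint V) * (V * modulus A)).
  by rewrite -[in LHS]V1 -!mulrA.
by rewrite Up -mulrA (mulrA (adjoint V)) VM.
Qed.

End Equivalence.

End BlockSVD.

Theorem theorem4p5 (R : realType) (H : hilbertType R)
    (Hsep : separable_space H) (Hinf : infinite_dimensional H)
    (A B : 'B(H)) (J : set 'B(H))
    (clA : closed_range A) (clB : closed_range B)
    (JP : proper_operator_ideal J)
    (diagA : diagonalizable_op (modulus A)) :
  let L := nonzero_point_spectrum (modulus A) in
  let V := bsvd_part A in
  let W := bsvd_part B in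
  (exists2 U, unitary_ideal J U & U * A = B)
  <->
  [/\ diagonalizable_op (modulus B),
      point_spectrum (modulus B) = point_spectrum (modulus A),
      (forall l, L l -> adjoint (V l) * V l = adjoint (W l) * W l),
      (exists2 S, J S & norm_series_cvg
         (fun l : L => (W (val l) - V (val l)) * adjoint (V (val l))) S) &
      (exists2 S, J S & norm_series_cvg
         (fun l : L => (V (val l) - W (val l)) * adjoint (W (val l))) S)].
Proof.
have [e be /(_ _)/cid eA] := diagA.
pose l n := sval (eA n).
have el n : modulus A (e n) = l n *: e n by rewrite /l; case: (eA n).
move=> L V W; split=> [[U JU UA]|[dB sp PV [S JS cS] _]].
  have [[UU _] _] := JU.
  have MB : modulus B = modulus A by rewrite -UA unitary_modulus.
  have [s1 s2] := unitary_series JP be el JU UA; split; [by rewrite MB..| |exact: s1|exact: s2].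
  move=> a La; rewrite /V /W (bsvd_initial La) bsvd_initial; first by rewrite MB.
  by rewrite MB.
have MB : modulus B = modulus A by exact: (modulus_eq be el dB sp PV).
exact: (series_unitary JP be el MB JS cS).
Qed.
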